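(* For all $n\ge 1$, $$\operatorname{rank}\, A^G_1(\Gamma(B_n))^{ab}=2^{n-3}(n^2-5n+8)-1,$$ where $A^G_1(\Gamma(B_n))^{ab}$ denotes the abelianization of the discrete fundamental group $A_1^G(\Gamma(B_n))$.
   Context: Let $S_n$ be the symmetric group on $\{1,\dots,n\}$, with permutations multiplied from right to left, and let $s_j=(j\ \ j{+}1)$, $1\le j\le n-1$, be the simple transpositions. $\Gamma(B_n)$ is the simple graph with vertex set $S_n$ in which $\sigma$ and $\tau$ are adjacent iff $\sigma=\tau s_j$ for some $1\le j\le n-1$. (Its vertices correspond to the maximal chains of the boolean lattice $B_n$, two chains being adjacent iff they differ in precisely one element; it is the 1-skeleton of the permutahedron.) A graph map between simple graphs is a map on vertices sending adjacent vertices to adjacent or equal vertices. The cartesian product $\Gamma\,\Box\,\Gamma'$ has vertex set $V\times V'$, with $(v,v')$ adjacent to $(w,w')$ iff either $v=w$ and $v'\sim w'$, or $v\sim w$ and $v'=w'$. Let $I$ be the infinite path with vertices $0,1,2,\dots$ and $I_m$ the path with vertices $0,1,\dots,m$. A loop in a graph $\Gamma$ based at $v_0$ is a graph map $f:I\to\Gamma$ with $f(0)=v_0$ and $f(r)=v_0$ for all $r\ge N_f$, for some positive integer $N_f$. Two loops $f,g$ based at $v_0$ are $G$-homotopic if there are an integer $m$ and a graph map $F:I\,\Box\, I_m\to\Gamma$ with $F(r,0)=f(r)$ and $F(r,m)=g(r)$ for all $r$, and such that each row $r\mapsto F(r,j)$, $0\le j\le m$, is a loop based at $v_0$. The set of $G$-homotopy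 classes of loops based at $v_0$ is a group $A_1^G(\Gamma,v_0)$ under concatenation of loops. If $\Gamma$ is connected it is independent of $v_0$ up to isomorphism and is denoted $A_1^G(\Gamma)$. ($A_1^G(\Gamma,v_0)$ is isomorphic to $\pi_1(\Gamma,v_0)/N$, where $\Gamma$ is viewed as a 1-dimensional complex and $N$ is the normal subgroup generated by the 3- and 4-cycles, i.e. to the fundamental group of the 2-complex obtained by attaching 2-cells to all 3- and 4-cycles of $\Gamma$.) *)

(* Defs.v *)
From HB Require Import structures.
From mathcomp Require Import all_boot all_order all_fingroup all_algebra.
From mathcomp Require Import generic_quotient boolp.
From mathcomp Require Import zify.

Set Implicit Arguments.
Unset Strict Implicit.
Unset Printing Implicit Defensive.

Import GRing.Theory.

Record sgraph := SGraph {
  vertex :> eqType;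
  adj : rel vertex;
  adj_irrefl : irreflexive adj;
  adj_sym : symmetric adj
}.

Definition adjeq (G : sgraph) : rel G := fun x y => (x == y) || adj x y.
Arguments adjeq : clear implicits.

Definition graph_map (G H : sgraph) (f : G -> H) :=
  forall x y : G, adj x y -> adjeq H (f x) (f y).

Section Box.
Variables G H : sgraph.

Definition box_adj : rel (G * H)%type := fun p q =>
  (p.1 == q.1) && adj p.2 q.2 || adj p.1 q.1 && (p.2 == q.2).

Fact box_irrefl : irreflexive box_adj.
Proof. by move=> p; rewrite /box_adj !adj_irrefl !andbF. Qed.

Fact box_sym : symmetric box_adj.
Proof.
move=> p q; rewrite /box_adj (eq_sym p.1) (eq_sym p.2).
by rewrite !(adj_sym p.1, adj_sym p.2).
Qed.

Definition box : sgraph := SGraph box_irrefl box_sym.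
End Box.

Definition consec : rel nat := fun i j => (j == i.+1) || (i == j.+1).

Fact consec_irrefl : irreflexive consec.
Proof. by move=> i; rewrite /consec ltn_eqF. Qed.

Fact consec_sym : symmetric consec.
Proof. by move=> i j; rewrite /consec orbC. Qed.

Definition ray : sgraph := SGraph consec_irrefl consec_sym.

(* The path with vertices 0, ..., m (it has m edges). *)
Definition path_graph (m : nat) : sgraph :=
  @SGraph 'I_m.+1 (fun i j => consec i j)
    (fun i => consec_irrefl i) (fun i j => consec_sym i j).

Definition is_loop (G : sgraph) (v0 : G) (f : ray -> G) : Prop :=
  [/\ graph_map f, f 0 = v0
    & exists N : nat, 0 < N /\ forall r, N <= r -> f r = v0].

Record loop (G : sgraph) (v0 : G) := Loop {
  loop_fun :> ray -> G;
  loopP : is_loop v0 loop_fun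
}.

HB.instance Definition _ (G : sgraph) (v0 : G) := gen_eqMixin (loop v0).
HB.instance Definition _ (G : sgraph) (v0 : G) := gen_choiceMixin (loop v0).

Definition G_homotopic (G : sgraph) (v0 : G) (f g : loop v0) : Prop :=
  exists (m : nat) (F : box ray (path_graph m) -> G),
    [/\ graph_map F,
        forall r, F (r, ord0) = f r,
        forall r, F (r, ord_max) = g r
      & forall j, is_loop v0 (fun r => F (r, j))].

Section Concatenation.
Variables (G : sgraph) (v0 : G).
Implicit Types f g h : loop v0.

Lemma adjeq_refl x : adjeq G x x.
Proof. by rewrite /adjeq eqxx. Qed.
Hint Resolve adjeq_refl : core.

Lemma adjeq_sym : symmetric (adjeq G).
Proof. by move=> x y; rewrite /adjeq eq_sym adj_sym. Qed.

Lemma ray_mapP (f : ray -> G) :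
  graph_map f <-> forall r, adjeq G (f r) (f r.+1).
Proof.
split=> [fG r|fS r s /orP[] /eqP-> //]; last by rewrite adjeq_sym.
by apply: fG; rewrite /= /consec eqxx.
Qed.

Lemma loopS f r : adjeq G (f r) (f r.+1).
Proof. by case: (loopP f) => /ray_mapP. Qed.

Lemma loop0 f : f 0 = v0.
Proof. by case: (loopP f). Qed.

Lemma loop_map_le f i j : i <= j.+1 -> j <= i.+1 -> adjeq G (f i) (f j).
Proof.
rewrite leq_eqVlt => /predU1P[->|ij]; first by rewrite adjeq_sym loopS.
rewrite leq_eqVlt => /predU1P[->|ji]; first exact: loopS.
by rewrite (_ : i = j)//; apply/eqP; rewrite eqn_leq; apply/andP.
Qed.

Definition loop_bound f (N : nat) :=
  `[< 0 < N /\ forall r, N <= r -> f r = v0 >].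

Fact loop_bound_ex f : exists N, loop_bound f N.
Proof. by case: (loopP f) => _ _ [N fN]; exists N; apply/asboolP. Qed.

(* N_f, taken to be the least admissible positive integer; another choice
   gives G-homotopic concatenations and inverses. *)
Definition loop_len f : nat := ex_minn (loop_bound_ex f).

Lemma loop_lenP f : loop_bound f (loop_len f).
Proof. by rewrite /loop_len; case: ex_minnP. Qed.

Lemma loop_bound_gt0 f N : loop_bound f N -> 0 < N.
Proof. by move/asboolP=> []. Qed.

Lemma loop_boundE f N r : loop_bound f N -> N <= r -> f r = v0.
Proof. by move/asboolP=> [_]; apply. Qed.

Lemma loop_bound_le f N M : loop_bound f N -> N <= M -> loop_bound f M.
Proof.
move=> fN NM; apply/asboolP; split=> [|r Mr].
  exact: leq_trans (loop_bound_gt0 fN) NM.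
by rewrite (loop_boundE fN)// (leq_trans NM).
Qed.

Lemma mk_is_loop (F : ray -> G) N : (forall r, adjeq G (F r) (F r.+1)) ->
  F 0 = v0 -> (forall r, N <= r -> F r = v0) -> is_loop v0 F.
Proof.
move=> FS F0 FN; split=> //; first exact/ray_mapP.
by exists N.+1; split=> // r /ltnW; apply: FN.
Qed.

Fact const_is_loop : is_loop v0 (fun _ : ray => v0).
Proof. exact: (@mk_is_loop _ 0). Qed.

Definition loop_const : loop v0 := Loop const_is_loop.

Definition cat_fun N f g : ray -> G :=
  fun r => if r <= N then f r else g (r - N).

Fact cat_is_loop N f g : loop_bound f N -> is_loop v0 (cat_fun N f g).
Proof.
move=> fN; apply: (@mk_is_loop _ (N + loop_len g)).
- move=> r; rewrite /cat_fun; case: (ltngtP r N) => [_|Nr|->].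
  + exact: loopS.
  + by rewrite subSn ?loopS// ltnW.
  + by rewrite (loop_boundE fN)// subSn// subnn -{1}(loop0 g) loopS.
- by rewrite /cat_fun loop0.
- move=> r Nr; rewrite /cat_fun; case: ifP => rN.
    by rewrite (loop_boundE fN)// (leq_trans _ Nr)// leq_addr.
  by rewrite (loop_boundE (loop_lenP g))// leq_subRL// (leq_trans _ Nr)// leq_addr.
Qed.

Definition loop_cat f g : loop v0 := Loop (cat_is_loop g (loop_lenP f)).

(* Truncated subtraction: the value is f 0 = v0 for r >= N. *)
Definition rev_fun N f : ray -> G := fun r => f (N - r).

Fact rev_is_loop N f : loop_bound f N -> is_loop v0 (rev_fun N f).
Proof.
move=> fN; apply: (@mk_is_loop _ N) => [r||r Nr]; rewrite /rev_fun.
- by rewrite loop_map_le//; case: (leqP N r) => h; lia.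
- by rewrite subn0 (loop_boundE fN).
- by move: Nr; rewrite -subn_eq0 => /eqP->; exact: loop0.
Qed.

Definition loop_rev f : loop v0 := Loop (rev_is_loop (loop_lenP f)).

End Concatenation.

Section Homotopy.
Variables (G : sgraph) (v0 : G).
Implicit Types f g h : loop v0.
Hint Resolve adjeq_refl : core.

Definition ghstep f g := forall r, adjeq G (f r) (g r).

Inductive ghsteps f : loop v0 -> Prop :=
| GHsteps0 : ghsteps f f
| GHstepsS g h of ghsteps f g & ghstep g h : ghsteps f h.

Lemma ghstep_sym f g : ghstep f g -> ghstep g f.
Proof. by move=> fg r; rewrite adjeq_sym. Qed.

Lemma ghstep1 f g : ghstep f g -> ghsteps f g.
Proof. exact: GHstepsS (GHsteps0 f). Qed.

Lemma eq_ghsteps f g : (forall r, f r = g r) -> ghsteps f g.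
Proof. by move=> fg; apply: ghstep1 => r; rewrite fg. Qed.

Lemma ghsteps_trans f g h : ghsteps f g -> ghsteps g h -> ghsteps f h.
Proof. by move=> fg; elim=> // h1 h2 _; apply: GHstepsS. Qed.

Lemma ghsteps_sym f g : ghsteps f g -> ghsteps g f.
Proof.
elim=> [|h1 h2 _ IH /ghstep_sym h21]; first exact: GHsteps0.
exact: ghsteps_trans (ghstep1 h21) IH.
Qed.

Lemma row_map m (F : box ray (path_graph m) -> G) : graph_map F ->
  forall r (i j : 'I_m.+1), consec i j -> adjeq G (F (r, i)) (F (r, j)).
Proof. by move=> FG r i j ij; apply: FG; rewrite /= /box_adj /= eqxx ij. Qed.

Lemma G_homotopicP f g : G_homotopic f g <-> ghsteps f g.
Proof.
split=> [[m [F [FG F0 Fm FL]]]|].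
  pose L (k : nat) := Loop (FL (inord k)).
  have FL0 k : k <= m -> ghsteps f (L k).
    elim: k => [_|k IH km].
      apply: eq_ghsteps => r /=; rewrite -F0; congr (F (_, _)).
      by apply/val_inj; rewrite /= inordK.
    apply: GHstepsS (IH (ltnW km)) _ => r /=; apply: row_map => //.
    by rewrite /consec !inordK ?eqxx// ltnW.
  apply: ghsteps_trans (FL0 m (leqnn m)) _; apply: eq_ghsteps => r /=.
  by rewrite -Fm; congr (F (_, _)); apply/val_inj; rewrite /= inordK.
elim=> [|g1 h _ [m [F [FG F0 Fm FL]]] g1h].
  exists 0, (fun p => f p.1); split=> //= [[r i] [s j]|j]; last first.
    exact: loopP f.
  rewrite /= /box_adj /= (ord1 i) (ord1 j) consec_irrefl andbF /= => /andP[rs _].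
  by case: (loopP f) => fG _ _; apply: fG.
pose F' (p : box ray (path_graph m.+1)) : G :=
  if p.2 <= m then F (p.1, inord p.2) else h p.1.
have F'm (r : nat) (j : 'I_m.+2) : (j : nat) = m -> F' (r, j) = g1 r.
  move=> jm; rewrite /F' /= jm leqnn -Fm; congr (F (_, _)).
  by apply/val_inj; rewrite /= inordK.
have F'm1 (r : nat) (j : 'I_m.+2) : (j : nat) = m.+1 -> F' (r, j) = h r.
  by move=> jm; rewrite /F' /= jm ltnn.
have F'L j : is_loop v0 (fun r => F' (r, j)).
  rewrite /F' /=; case: (j <= m); first exact: FL.
  exact: loopP h.
have F'S (r : nat) (i j : 'I_m.+2) : (j : nat) = i.+1 ->
    adjeq G (F' (r, i)) (F' (r, j)).
  move=> ji; have := ltn_ord j; rewrite ji !ltnS leq_eqVlt => /predU1P[im|im].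
    by rewrite (F'm _ _ im) F'm1 ?ji ?im.
  rewrite /F' /= ji im ltnW//; apply: row_map => //.
  by rewrite /consec !inordK ?eqxx// ltnS ltnW.
exists m.+1, F'; split=> //.
- move=> [r i] [s j]; rewrite /= /box_adj /= => /orP[]/andP[].
    move=> /eqP-> /orP[]/eqP; first exact: F'S.
    by move=> ij; rewrite adjeq_sym F'S.
  by move=> rs /eqP->; case: (F'L j) => F'G _ _; apply: F'G.
- move=> r; rewrite /F' /= -F0; congr (F (_, _)).
  by apply/val_inj; rewrite /= inordK.
- by move=> r; rewrite F'm1.
Qed.

Definition G_homotopicb : rel (loop v0) := fun f g => `[< G_homotopic f g >].

Lemma G_homotopicbP f g : reflect (ghsteps f g) (G_homotopicb f g).
Proof. by apply: (iffP (asboolP _)) => /G_homotopicP. Qed.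

Fact G_homotopicb_refl : reflexive G_homotopicb.
Proof. by move=> f; apply/G_homotopicbP; exact: GHsteps0. Qed.

Fact G_homotopicb_sym : symmetric G_homotopicb.
Proof.
by move=> f g; apply/idP/idP => /G_homotopicbP/ghsteps_sym/G_homotopicbP.
Qed.

Fact G_homotopicb_trans : transitive G_homotopicb.
Proof.
by move=> g f h /G_homotopicbP fg /G_homotopicbP /(ghsteps_trans fg)/G_homotopicbP.
Qed.

Canonical G_homotopic_equiv :=
  EquivRel G_homotopicb G_homotopicb_refl G_homotopicb_sym G_homotopicb_trans.

(* Repeating the k-th vertex of a loop does not change its class. *)
Definition stut_fun k f : ray -> G := fun r => if r <= k then f r else f r.-1.

Fact stut_is_loop k f : is_loop v0 (stut_fun k f).
Proof.
have fN := loop_lenP f; apply: (@mk_is_loop _ _ _ (loop_len f).+1).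
- move=> r; rewrite /stut_fun /=; case: (ltngtP r k) => [_|kr|->] //.
    exact: loopS.
  by case: r kr => // r _; exact: loopS.
- by rewrite /stut_fun loop0.
- by move=> r Nr; rewrite /stut_fun; case: ifP => _; apply: (loop_boundE fN); lia.
Qed.

Definition stut k f : loop v0 := Loop (stut_is_loop k f).

Lemma ghsteps_stut0 k f : ghsteps (stut 0 f) (stut k f).
Proof.
elim: k => [|k IH]; first exact: GHsteps0.
apply: GHstepsS IH _ => r; rewrite /= /stut_fun.
case: (ltngtP r k.+1) => [rk|rk|->].
- by rewrite (ltnSE rk).
- by rewrite [r <= k]leqNgt (ltnW rk).
- by rewrite ltnn loopS.
Qed.

Lemma ghsteps_stut k f : ghsteps f (stut k f).
Proof.
have fN := loop_lenP f.
apply: ghsteps_trans (ghsteps_stut0 k f).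
apply: ghsteps_trans (ghsteps_sym (ghsteps_stut0 (loop_len f) f)).
apply: eq_ghsteps => r /=; rewrite /stut_fun; case: leqP => // Nr.
by rewrite !(loop_boundE fN) //; lia.
Qed.

Definition catN N f g (fN : loop_bound f N) : loop v0 := Loop (cat_is_loop g fN).
Definition revN N f (fN : loop_bound f N) : loop v0 := Loop (rev_is_loop fN).

Lemma catN_indep N M f g (fN : loop_bound f N) (fM : loop_bound f M) :
  ghsteps (catN g fN) (catN g fM).
Proof.
wlog NM : N M fN fM / N <= M.
  move=> H; case: (leqP N M) => [|/ltnW] NM; first exact: H.
  exact/ghsteps_sym/H.
elim: M fM NM => [|M IH] fM.
  by rewrite leqn0 => /eqP N0; apply: eq_ghsteps => r /=; rewrite N0.
rewrite leq_eqVlt => /predU1P[NM|NM].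
  by apply: eq_ghsteps => r /=; rewrite NM.
have fM' := loop_bound_le fN (ltnSE NM).
apply: ghsteps_trans (IH fM' (ltnSE NM)) _.
apply: ghsteps_trans (ghsteps_stut M _) _; apply: eq_ghsteps => r /=.
rewrite /stut_fun /= /cat_fun; case: (ltngtP r M.+1) => [rM|rM|->].
- by rewrite (ltnSE rM).
- by rewrite !ifF; [congr (g _)| |]; lia.
- by rewrite ltnn /= leqnn !(loop_boundE fM').
Qed.

Lemma revN_indep N M f (fN : loop_bound f N) (fM : loop_bound f M) :
  ghsteps (revN fN) (revN fM).
Proof.
wlog NM : N M fN fM / N <= M.
  move=> H; case: (leqP N M) => [|/ltnW] NM; first exact: H.
  exact/ghsteps_sym/H.
elim: M fM NM => [|M IH] fM.
  by rewrite leqn0 => /eqP N0; apply: eq_ghsteps => r /=; rewrite N0.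
rewrite leq_eqVlt => /predU1P[NM|NM].
  by apply: eq_ghsteps => r /=; rewrite NM.
have fM' := loop_bound_le fN (ltnSE NM).
apply: ghsteps_trans (IH fM' (ltnSE NM)) _.
apply: ghsteps_trans (ghsteps_stut 0 _) _; apply: eq_ghsteps => r /=.
rewrite /stut_fun /= /rev_fun; case: r => [|r] /=.
  by rewrite !subn0 !(loop_boundE fM').
by rewrite subSS.
Qed.

Lemma loop_cat_homo f f' g g' : ghsteps f f' -> ghsteps g g' ->
  ghsteps (loop_cat f g) (loop_cat f' g').
Proof.
move=> ff' gg'; apply: (@ghsteps_trans _ (loop_cat f' g)); last first.
  elim: gg' => [|g1 h _ IH g1h]; first exact: GHsteps0.
  by apply: GHstepsS IH _ => r /=; rewrite /cat_fun; case: ifP.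
elim: ff' => [|f1 h _ IH f1h]; first exact: GHsteps0.
apply: ghsteps_trans IH _.
have f1N := loop_bound_le (loop_lenP f1) (leq_maxl _ (loop_len h)).
have hN := loop_bound_le (loop_lenP h) (leq_maxr (loop_len f1) _).
apply: ghsteps_trans (catN_indep _ _ f1N) _.
apply: (@ghsteps_trans _ (catN g hN)); last exact: catN_indep.
by apply: ghstep1 => r /=; rewrite /cat_fun; case: ifP.
Qed.

Lemma loop_rev_homo f f' : ghsteps f f' -> ghsteps (loop_rev f) (loop_rev f').
Proof.
elim=> [|f1 h _ IH f1h]; first exact: GHsteps0.
apply: ghsteps_trans IH _.
have f1N := loop_bound_le (loop_lenP f1) (leq_maxl _ (loop_len h)).
have hN := loop_bound_le (loop_lenP h) (leq_maxr (loop_len f1) _).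
apply: ghsteps_trans (revN_indep _ f1N) _.
apply: (@ghsteps_trans _ (revN hN)); last exact: revN_indep.
by apply: ghstep1 => r /=; rewrite /rev_fun.
Qed.

Lemma loop_catA f g h :
  ghsteps (loop_cat f (loop_cat g h)) (loop_cat (loop_cat f g) h).
Proof.
have fN := loop_lenP f; have gM := loop_lenP g.
have fgNM : loop_bound (loop_cat f g) (loop_len f + loop_len g).
  apply/asboolP; split; first by rewrite addn_gt0 (loop_bound_gt0 fN).
  move=> r NMr; rewrite /= /cat_fun; case: leqP => rN.
    by rewrite (loop_boundE fN) //; lia.
  by rewrite (loop_boundE gM) //; lia.
apply: (@ghsteps_trans _ (catN h fgNM)); last exact: catN_indep.
apply: eq_ghsteps => r /=; rewrite /cat_fun /=.
case: (leqP r (loop_len f)) => [rN|Nr].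
  by rewrite /cat_fun rN (leq_trans rN (leq_addr _ _)).
rewrite /cat_fun leq_subLR [r <= loop_len f]leqNgt Nr /= subnDA.
by case: ifP.
Qed.

Lemma loop_cat1l f : ghsteps (loop_cat (loop_const v0) f) f.
Proof.
have cN : loop_bound (loop_const v0) 1 by apply/asboolP.
apply: ghsteps_trans (catN_indep _ _ cN) _.
apply: ghsteps_trans (ghsteps_sym (ghsteps_stut 0 f)).
apply: eq_ghsteps => r /=; rewrite /cat_fun /stut_fun /=.
by case: r => [|[|r]]; rewrite //= ?loop0 // ?subn1.
Qed.

Lemma loop_cat1r f : ghsteps (loop_cat f (loop_const v0)) f.
Proof.
apply: eq_ghsteps => r /=; rewrite /cat_fun /=; case: leqP => // /ltnW rN.
by rewrite (loop_boundE (loop_lenP f)).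
Qed.

Lemma catNV N f (fN : loop_bound f N) (g := revN fN) :
  ghsteps (catN g fN) (loop_const v0).
Proof.
pose F k r := f (minn k (minn r (N + N - r))).
have FL k : is_loop v0 (F k).
  apply: (@mk_is_loop _ _ _ (N + N)).
  - by move=> r; apply: loop_map_le; lia.
  - by rewrite /F min0n minn0 loop0.
  - move=> r Nr; rewrite /F (_ : minn _ _ = 0) ?loop0 //; lia.
pose L k := Loop (FL k).
have LS k : ghsteps (L k) (loop_const v0).
  elim: k => [|k IH]; first by apply: eq_ghsteps => r /=; rewrite /F min0n loop0.
  apply: ghsteps_trans IH; apply: ghstep1 => r /=.
  by apply: loop_map_le; lia.
apply: ghsteps_trans (LS N); apply: eq_ghsteps => r /=.
by rewrite /cat_fun /F /= /rev_fun; case: leqP => rN; congr (f _); lia.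
Qed.

Lemma loop_catV f : ghsteps (loop_cat f (loop_rev f)) (loop_const v0).
Proof. exact: catNV. Qed.

Lemma loop_catVl f : ghsteps (loop_cat (loop_rev f) f) (loop_const v0).
Proof.
have fN := loop_lenP f.
have rN : loop_bound (loop_rev f) (loop_len f).
  apply/asboolP; split; first exact: loop_bound_gt0 fN.
  by move=> r; rewrite -subn_eq0 /= /rev_fun => /eqP->; rewrite loop0.
apply: ghsteps_trans (catNV rN); apply: ghsteps_trans (catN_indep _ _ rN) _.
apply: eq_ghsteps => r /=; rewrite /cat_fun /= /rev_fun /=; case: ifP => // _.
case: (leqP (r - loop_len f) (loop_len f)) => h; first by congr (f _); rewrite subKn.
by rewrite (loop_boundE fN (ltnW h)) (loop_boundE fN) // leq_subRL; lia.
Qed.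

End Homotopy.

Definition A1G (G : sgraph) (v0 : G) := {eq_quot (@G_homotopic_equiv G v0)}%qT.

HB.instance Definition _ (G : sgraph) (v0 : G) := Choice.on (A1G v0).
HB.instance Definition _ (G : sgraph) (v0 : G) := EqQuotient.on (A1G v0).

Section A1GGroup.
Local Open Scope quotient_scope.
Variables (G : sgraph) (v0 : G).
Local Notation A := (A1G v0).

Definition A1G_one : A := \pi_A (loop_const v0).
Definition A1G_mul (x y : A) : A := \pi_A (loop_cat (repr x) (repr y)).
Definition A1G_inv (x : A) : A := \pi_A (loop_rev (repr x)).

Lemma A1G_piP (f g : loop v0) : ghsteps f g <-> f = g %[mod A].
Proof. by split=> [fg|/eqmodP/G_homotopicbP//]; apply/eqmodP/G_homotopicbP. Qed.

Lemma A1G_mulE f g : A1G_mul (\pi_A f) (\pi_A g) = \pi_A (loop_cat f g).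
Proof. by apply/A1G_piP/loop_cat_homo; apply/A1G_piP; rewrite reprK. Qed.

Lemma A1G_invE f : A1G_inv (\pi_A f) = \pi_A (loop_rev f).
Proof. by apply/A1G_piP/loop_rev_homo; apply/A1G_piP; rewrite reprK. Qed.

Fact A1G_mulA : associative A1G_mul.
Proof.
elim/quotW=> f; elim/quotW=> g; elim/quotW=> h.
rewrite (A1G_mulE g h) (A1G_mulE f g) !A1G_mulE.
exact/A1G_piP/loop_catA.
Qed.

Fact A1G_mul1g : left_id A1G_one A1G_mul.
Proof. by elim/quotW=> f; rewrite A1G_mulE; exact/A1G_piP/loop_cat1l. Qed.

Fact A1G_mulg1 : right_id A1G_one A1G_mul.
Proof. by elim/quotW=> f; rewrite A1G_mulE; exact/A1G_piP/loop_cat1r. Qed.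

Fact A1G_mulVg : left_inverse A1G_one A1G_inv A1G_mul.
Proof.
by elim/quotW=> f; rewrite A1G_invE A1G_mulE; exact/A1G_piP/loop_catVl.
Qed.

Fact A1G_mulgV : right_inverse A1G_one A1G_inv A1G_mul.
Proof.
by elim/quotW=> f; rewrite A1G_invE A1G_mulE; exact/A1G_piP/loop_catV.
Qed.

HB.instance Definition _ := isGroup.Build A
  A1G_mulA A1G_mul1g A1G_mulg1 A1G_mulVg A1G_mulgV.

End A1GGroup.

Section Abelianization.
Local Open Scope group_scope.
Local Open Scope quotient_scope.
Variable G : groupType.
Implicit Types x y z : G.

Definition commutator_subgroup : {pred G} := fun x =>
  `[< forall S : {pred G}, group_closed S ->
        (forall y z, [~ y, z] \in S) -> x \in S >].

Local Notation D := commutator_subgroup.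

Lemma comm_in y z : [~ y, z] \in D.
Proof. by apply/asboolP => S _; apply. Qed.

Lemma comm_closed : group_closed D.
Proof.
split; first by apply/asboolP => S [].
move=> x y /asboolP Dx /asboolP Dy; apply/asboolP => S SG SR.
by apply: SG.2; [exact: Dx|exact: Dy].
Qed.

Lemma comm1 : 1 \in D. Proof. exact: comm_closed.1. Qed.

Lemma commV x : x \in D -> x^-1 \in D.
Proof.
by move=> Dx; rewrite -div1g; apply: comm_closed.2 => //; exact: comm1.
Qed.

Lemma commM x y : x \in D -> y \in D -> x * y \in D.
Proof.
move=> Dx Dy; rewrite -[y]invgK; apply: comm_closed.2 => //.
exact: commV.
Qed.

Lemma commJ x y : x \in D -> x ^ y \in D.
Proof.
move=> Dx; rewrite (_ : x ^ y = x * [~ x, y]); first by rewrite commM ?comm_in.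
by rewrite /commg mulKVg.
Qed.

Definition ab_rel : rel G := fun x y => x^-1 * y \in D.

Fact ab_refl : reflexive ab_rel.
Proof. by move=> x; rewrite /ab_rel mulVg comm1. Qed.

Fact ab_sym : symmetric ab_rel.
Proof.
have H x y : ab_rel x y -> ab_rel y x.
  by rewrite /ab_rel => /commV; rewrite invgM invgK.
by move=> x y; apply/idP/idP; exact: H.
Qed.

Fact ab_trans : transitive ab_rel.
Proof.
move=> y x z xy yz; have := commM xy yz.
by rewrite -mulgA mulKVg.
Qed.

Canonical ab_equiv := EquivRel ab_rel ab_refl ab_sym ab_trans.

Definition abelianization := {eq_quot ab_equiv}.
Local Notation A := abelianization.

HB.instance Definition _ := Choice.on A.
HB.instance Definition _ := EqQuotient.on A.

Definition ab_zero : A := \pi_A 1.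
Definition ab_add (x y : A) : A := \pi_A (repr x * repr y).
Definition ab_opp (x : A) : A := \pi_A (repr x)^-1.

Lemma ab_piP x y : ab_rel x y <-> x = y %[mod A].
Proof. by split=> [|/eqmodP//] ?; apply/eqmodP. Qed.

Lemma ab_relM x x' y y' : ab_rel x x' -> ab_rel y y' -> ab_rel (x * y) (x' * y').
Proof.
rewrite /ab_rel => xx' yy'; rewrite invgM.
have -> : y^-1 * x^-1 * (x' * y') = (x^-1 * x') ^ y * (y^-1 * y').
  by rewrite /conjg !mulgA mulgK.
by rewrite commM // commJ.
Qed.

Lemma ab_addE x y : ab_add (\pi_A x) (\pi_A y) = \pi_A (x * y).
Proof. by apply/ab_piP/ab_relM; apply/ab_piP; rewrite reprK. Qed.

Lemma ab_oppE x : ab_opp (\pi_A x) = \pi_A x^-1.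
Proof.
apply/ab_piP; rewrite /ab_rel invgK.
have /ab_piP : repr (\pi_A x) = x %[mod A] by rewrite reprK.
move: (repr _) => y /(commJ x^-1)/commV.
by rewrite /conjg -mulgA mulgV mulg1 invgK invgM invgK.
Qed.

Fact ab_addA : associative ab_add.
Proof.
elim/quotW=> x; elim/quotW=> y; elim/quotW=> z.
by rewrite (ab_addE y z) (ab_addE x y) !ab_addE mulgA.
Qed.

Fact ab_addC : commutative ab_add.
Proof.
elim/quotW=> x; elim/quotW=> y; rewrite !ab_addE; apply/ab_piP.
rewrite /ab_rel invgM -mulgA; exact: comm_in.
Qed.

Fact ab_add0 : left_id ab_zero ab_add.
Proof. by elim/quotW=> x; rewrite ab_addE mul1g. Qed.

Fact ab_addN : left_inverse ab_zero ab_opp ab_add.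
Proof. by elim/quotW=> x; rewrite ab_oppE ab_addE mulVg. Qed.

HB.instance Definition _ := GRing.isZmodule.Build A ab_addA ab_addC ab_add0 ab_addN.

End Abelianization.

Definition Z_independent (A : zmodType) (k : nat) (x : 'I_k -> A) : Prop :=
  forall c : 'I_k -> int, (\sum_i x i *~ c i = 0)%R -> forall i, c i = 0%R.

(* Torsion-free rank of A: the largest size of a Z-independent family exists
   and equals r. *)
Definition has_rank (A : zmodType) (r : nat) : Prop :=
  (exists x : 'I_r -> A, Z_independent x) /\
  (forall (k : nat) (x : 'I_k -> A), Z_independent x -> k <= r).

Section GammaB.
Local Open Scope group_scope.
Variable n : nat.

(* MathComp composes permutations from left to right, so the right-to-left
   product sigma s_j is written s_j * sigma. *)
Definition GammaB_adj : rel 'S_n := fun sigma tau =>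
  [exists i : 'I_n, exists j : 'I_n,
     (j == i.+1 :> nat) && (sigma == tperm i j * tau)].

Fact GammaB_irrefl : irreflexive GammaB_adj.
Proof.
move=> s; apply/existsP => -[i /existsP[j /andP[/eqP ji /eqP]]].
move=> /(congr1 (fun t => t * s^-1)); rewrite mulgK mulgV => /permP/(_ i).
by rewrite perm1 tpermL => ij; move: ji; rewrite -ij => /n_Sn.
Qed.

Fact GammaB_sym : symmetric GammaB_adj.
Proof.
have H s t : GammaB_adj s t -> GammaB_adj t s.
  move=> /existsP[i /existsP[j /andP[ji /eqP->]]].
  apply/existsP; exists i; apply/existsP; exists j.
  by rewrite ji mulgA tperm2 mul1g /=.
by move=> s t; apply/idP/idP; exact: H.
Qed.

Definition GammaB : sgraph := SGraph GammaB_irrefl GammaB_sym.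
End GammaB.

(* Main.v *)
From HB Require Import structures.
From mathcomp Require Import all_boot all_order all_fingroup all_algebra.
From mathcomp Require Import generic_quotient boolp zify ring lra.
Require Import Defs.

(* Read a permutation as the word of its values, i.e. as a maximal chain of the
   boolean lattice; an edge of the graph then sweeps a 2-dimensional face of the
   cube.  Counting the signed sweeps of each 2-face is a homotopy invariant of
   loops, since a 4-cycle of the graph exchanges two disjoint pairs of letters
   and so sweeps each of its two faces back and forth.  Conversely, the holonomy
   of a cocycle along the hexagon that permutes three consecutive letters x, b, c
   depends only on the set u of letters before them, i.e. on a 3-face of the cube
   (prisms over a hexagon are filled by 4-cycles).  Fix an order of the letters
   and call the 3-face critical if u contains all the letters smaller than
   x = min(x, b, c).
   - The critical hexagons are independent: the 2-face (u, {b, c}) is swept by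
     the hexagon of (u, {x, b, c}) and by no other critical hexagon with the
     same or a larger least letter.
   - They generate: a cocycle that vanishes on them has a potential, built by
     induction on the alphabet by carrying the least letter to its place from
     the front of the word.
   For each i < n there are C(i, 2) 2^(i - 2) critical 3-faces whose least letter
   is followed by i letters of the alphabet. *)

Set Implicit Arguments.
Unset Strict Implicit.
Unset Printing Implicit Defensive.

Import GRing.Theory.
Local Open Scope ring_scope.

(** * Words and hexagons *)

(** In [0 + (x - y)], once flattened, every summand other than the leading 0 has a left neighbour,
    so [zmod_cancel] can move [t] and [- t] to the end with [addrAC] and cancel them there. *)
Lemma eq_from_sub0 (M : zmodType) (x y : M) : 0 + (x - y) = 0 -> x = y.
Proof. by rewrite add0r => /subr0_eq. Qed.

Ltac zmod_cancel :=
  apply: eq_from_sub0; rewrite ?addr0 ?opprD ?opprK ?oppr0 ?addr0 ?addrA;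
  do 30? match goal with
  | |- context [- ?t] => rewrite 20?(addrAC _ t) 20?(addrAC _ (- t)) ?addrK ?addrNK
  end; rewrite ?addr0; try reflexivity.

(** Adjacent swaps reach every rearrangement: [t] is built from the left behind a frozen prefix [p],
    its next letter being carried leftwards up to [p]. *)
Lemma perm_swap_ind (T : eqType) (Q : seq T -> Prop) :
    (forall u a b v, Q (u ++ a :: b :: v) -> Q (u ++ b :: a :: v)) ->
  forall s t, perm_eq s t -> Q s -> Q t.
Proof.
move=> Qswap s t st Qs; suff /(_ t [::] s st) : forall t p s,
  perm_eq s t -> Q (p ++ s) -> Q (p ++ t) by apply.
move=> {s st Qs}t; elim: t => [p s|y t IH p s st].
  by move/perm_size/size0nil->.
have /splitPr sy : y \in s by rewrite (perm_mem st) mem_head.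
case: sy st => s1 s2 st Qs; rewrite -cat_rcons; apply: (IH _ (s1 ++ s2)).
  rewrite -(perm_cons y); apply: perm_trans st.
  by rewrite -[y :: _](cat1s y (s1 ++ s2)) perm_catCA.
rewrite cat_rcons; elim/last_ind: s1 {st} s2 Qs => [//|s1 z IH1] s2.
rewrite !cat_rcons => Qs; apply: (IH1 (z :: s2)).
by rewrite catA; apply: Qswap; rewrite -catA.
Qed.

(** * Faces of the boolean lattice, their enumeration and count *)

Section Faces.
Variable T : eqType.
Implicit Types (s p : seq T) (f g : seq T * seq T * seq T).

(* A triple [(u, m, v)] stands for the face of the boolean lattice made of the
   sets between [u] and [u ++ m]; [faces k s] lists its [k]-faces. *)
Fixpoint faces k s : seq (seq T * seq T * seq T) :=
  if s is x :: s' then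
    [seq (x :: f.1.1, f.1.2, f.2) | f <- faces k s'] ++
    [seq (f.1.1, f.1.2, x :: f.2) | f <- faces k s'] ++
    (if k is k'.+1 then [seq (f.1.1, x :: f.1.2, f.2) | f <- faces k' s']
     else [::])
  else if k is 0 then [:: ([::], [::], [::])] else [::].

(* The faces [(u, x :: m, v)] of dimension 3 such that every element of [s]
   before [x] belongs to [u]. *)
Fixpoint critical p s : seq (seq T * seq T * seq T) :=
  if s is x :: s' then
    [seq (p ++ f.1.1, x :: f.1.2, f.2) | f <- faces 2 s'] ++
    critical (rcons p x) s'
  else [::].

(** Lets a face given by sets of letters be found in the list, where each component follows the
    order of [s]. *)
Lemma faces_filter (A C : pred T) s :
  ([seq y <- s | A y], [seq y <- s | ~~ A y && ~~ C y],
   [seq y <- s | ~~ A y && C y])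
    \in faces (count (fun y => ~~ A y && ~~ C y) s) s.
Proof.
elim: s => [//|x s IH] /=; rewrite !mem_cat.
case Ax: (A x) => /=; first by rewrite (map_f (fun f => (x :: f.1.1, f.1.2, f.2)) IH).
case Cx: (C x) => /=; rewrite ?add0n ?add1n.
  by rewrite (map_f (fun f => (f.1.1, f.1.2, x :: f.2)) IH) orbT.
by rewrite (map_f (fun f => (f.1.1, x :: f.1.2, f.2)) IH) !orbT.
Qed.

Lemma faces_spec k s f : f \in faces k s ->
  [/\ subseq f.1.1 s, subseq f.1.2 s, subseq f.2 s, size f.1.2 = k
    & perm_eq (f.1.1 ++ f.1.2 ++ f.2) s].
Proof.
elim: s k f => [|x s IH] [|k] f //=; first by rewrite inE => /eqP->.
  rewrite cats0 mem_cat => /orP[] /mapP[g /IH[g1 g2 g3 gk gs] ->] /=.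
    by rewrite eqxx perm_cons; split=> //; apply: subseq_trans (subseq_cons _ _).
  rewrite eqxx; split=> //; try exact: subseq_trans (subseq_cons _ _).
  by rewrite -cat1s catA perm_catCA -catA perm_cons.
rewrite !mem_cat => /or3P[] /mapP[g /IH[g1 g2 g3 gk gs] ->] /=; rewrite eqxx.
- by rewrite perm_cons; split=> //; apply: subseq_trans (subseq_cons _ _).
- split=> //; try exact: subseq_trans (subseq_cons _ _).
  by rewrite -cat1s catA perm_catCA -catA perm_cons.
- split=> //; try exact: subseq_trans (subseq_cons _ _); first by rewrite gk.
  by rewrite -cat1s perm_catCA perm_cons.
Qed.

Lemma subseq_perm_eq s s1 s2 : uniq s -> subseq s1 s -> subseq s2 s ->
  perm_eq s1 s2 -> s1 = s2.
Proof.
move=> Us /(subseq_uniqP Us) e1 /(subseq_uniqP Us) e2 /perm_mem s12.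
by rewrite e1 e2; apply: eq_filter => y /=; exact: s12.
Qed.

Lemma faces_uniq k s : uniq s -> uniq (faces k s).
Proof.
elim: s k => [|x s IH] [|k] //= /andP[xs Us].
  rewrite cats0 cat_uniq !map_inj_uniq ?IH //=; first last.
  - by move=> [[a b] c] [[a' b'] c'] [-> -> ->].
  - by move=> [[a b] c] [[a' b'] c'] [-> -> ->].
  rewrite andbT; apply/hasPn => _ /mapP[f /faces_spec[fs _ _ _ _] ->].
  apply/mapP => -[g _ [fg]]; case/negP: xs.
  by apply: (mem_subseq fs); rewrite fg mem_head.
rewrite !cat_uniq !map_inj_uniq ?IH //=; first last.
- by move=> [[a b] c] [[a' b'] c'] [-> -> ->].
- by move=> [[a b] c] [[a' b'] c'] [-> -> ->].
- by move=> [[a b] c] [[a' b'] c'] [-> -> ->].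
rewrite has_cat negb_or !andbT -andbA; apply/and3P; split; apply/hasPn.
- move=> _ /mapP[f /faces_spec[fs _ _ _ _] ->].
  apply/mapP => -[g _ [fg]]; case/negP: xs.
  by apply: (mem_subseq fs); rewrite fg mem_head.
- move=> _ /mapP[f /faces_spec[fs _ _ _ _] ->].
  apply/mapP => -[g _ [fg]]; case/negP: xs.
  by apply: (mem_subseq fs); rewrite fg mem_head.
- move=> _ /mapP[f /faces_spec[_ _ fs _ _] ->].
  apply/mapP => -[g _ [_ _ fg]]; case/negP: xs.
  by apply: (mem_subseq fs); rewrite fg mem_head.
Qed.

Lemma size_faces k s : size (faces k s) = ('C(size s, k) * 2 ^ (size s - k))%N.
Proof.
elim: s k => [|x s IH] [|k] //=; rewrite !size_cat !size_map !IH.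
  by rewrite !bin0 !subn0 !mul1n addn0 addnn -mul2n expnS.
rewrite binS subSS mulnDl addnA; congr addn.
case: (leqP k.+1 (size s)) => ks; last by rewrite bin_small.
by rewrite -(subnSK ks) expnS mul2n -addnn mulnDr.
Qed.

Lemma size_critical p s :
  size (critical p s) = (\sum_(k < size s) 'C(k, 2) * 2 ^ (k - 2))%N.
Proof.
elim: s p => [|x s IH] p /=; first by rewrite big_ord0.
by rewrite size_cat size_map size_faces IH big_ord_recr addnC.
Qed.

Lemma critical_spec p s g : g \in critical p s ->
  exists x b c, g.1.2 = [:: x; b; c] /\
    perm_eq (g.1.1 ++ x :: b :: c :: g.2) (p ++ s).
Proof.
elim: s p => [//|x s IH] p /=; rewrite mem_cat => /orP[|/IH]; last first.
  by rewrite cat_rcons.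
move=> /mapP[[[u m] v] /faces_spec[/= _ _ _ sz_m fs] ->].
case: m sz_m fs => [|b [|c []]] //= _ fs; exists x, b, c; split=> //=.
rewrite -catA perm_cat2l.
by rewrite -[_ :: _]/([:: x] ++ [:: b, c & v]) perm_catCA perm_cons.
Qed.

(** Separates the faces with least letter [x] from the later ones, whose first component contains
    [x]. *)
Lemma critical_prefix p s g : g \in critical p s -> prefix p g.1.1.
Proof.
elim: s p => [//|x s IH] p /=; rewrite mem_cat => /orP[/mapP[f _ ->]|/IH].
  exact: prefix_prefix.
by apply: prefix_trans; rewrite -cats1 prefix_prefix.
Qed.

Lemma critical_uniq p s : uniq s -> uniq (critical p s).
Proof.
elim: s p => [//|x s IH] p /= /andP[xs Us].
rewrite cat_uniq map_inj_in_uniq ?faces_uniq ?IH //=; last first.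
  move=> [[a b] c] [[a' b'] c'] _ _ [/eqP].
  by rewrite eqseq_cat // eqxx => /eqP-> -> ->.
rewrite andbT; apply/hasPn => g /critical_prefix pg.
apply/mapP => -[f /faces_spec[fs _ _ _ _] gf]; case/negP: xs.
apply: (mem_subseq fs); case/prefixP: pg => y; rewrite gf /= cat_rcons => /eqP.
by rewrite eqseq_cat // eqxx => /eqP->; rewrite mem_head.
Qed.

End Faces.

(** * Hexagons and potentials of a cocycle on words *)

Section Cocycle.
(** [e u a b v] is read as the value on the edge from [u ++ a :: b :: v] to [u ++ b :: a :: v]. It
    changes sign with the direction and is closed on the 4-cycles that exchange two disjoint
    pairs. *)
Variables (T : eqType) (M : zmodType) (e : seq T -> T -> T -> seq T -> M).

Hypothesis e_anti : forall u a b v, e u b a v = - e u a b v.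
Hypothesis e_square : forall u a b x c d v,
  e u a b (x ++ c :: d :: v) + e (u ++ b :: a :: x) c d v =
  e (u ++ a :: b :: x) c d v + e u a b (x ++ d :: c :: v).

(* Holonomy around the hexagon of the six orders of [x, b, c] *)
Definition hex u x b c v : M :=
  e u x b (c :: v) + e (rcons u b) x c v + e u b c (x :: v)
  - (e (rcons u x) b c v + e u x c (b :: v) + e (rcons u c) x b v).

Definition face_hex (g : seq T * seq T * seq T) : M :=
  if g.1.2 is [:: x; b; c] then hex g.1.1 x b c g.2 else 0.

Lemma hex_anti u x b c v : hex u x c b v = - hex u x b c v.
Proof.
rewrite /hex (e_anti u b c) (e_anti (rcons u x) b c).
zmod_cancel.
Qed.

Lemma e_square_left u a b x c d v :
  e (u ++ b :: a :: x) c d v =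
  e (u ++ a :: b :: x) c d v + e u a b (x ++ d :: c :: v)
  - e u a b (x ++ c :: d :: v).
Proof. by rewrite -e_square addrAC subrr add0r. Qed.

(** The two hexagons bound a prism with square sides; the edges exchanging [d] and [f], shared by
    neighbouring squares, cancel around it. *)
Lemma hex_swapl u1 d f u2 x b c v :
  hex (u1 ++ f :: d :: u2) x b c v = hex (u1 ++ d :: f :: u2) x b c v.
Proof.
rewrite /hex !rcons_cat !rcons_cons !(e_square_left u1 d f) !cat_rcons.
zmod_cancel.
Qed.

Lemma e_square_right u a b x c d v :
  e u a b (x ++ d :: c :: v) =
  e u a b (x ++ c :: d :: v) + e (u ++ b :: a :: x) c d v
   - e (u ++ a :: b :: x) c d v.
Proof. by rewrite e_square addrAC subrr add0r. Qed.

Lemma hex_swapr u x b c v1 d f v2 :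
  hex u x b c (v1 ++ f :: d :: v2) = hex u x b c (v1 ++ d :: f :: v2).
Proof.
rewrite /hex -!cat_cons !(e_square_right _ _ _ _ d f) /= !cat_rcons.
zmod_cancel.
Qed.

Lemma hex_perm u u' x b c v v' : perm_eq u u' -> perm_eq v v' ->
  hex u x b c v = hex u' x b c v'.
Proof.
move=> uu' vv'; transitivity (hex u' x b c v).
  pose Q u' := hex u x b c v = hex u' x b c v.
  by apply: (@perm_swap_ind _ Q _ _ _ uu') => // u1 d f u2; rewrite /Q => ->; rewrite hex_swapl.
pose Q v' := hex u' x b c v = hex u' x b c v'.
by apply: (@perm_swap_ind _ Q _ _ _ vv') => // v1 d f v2; rewrite /Q => ->; rewrite hex_swapr.
Qed.

(** Potentials are built modulo a subgroup [B]. With [B] the span of the critical hexagons,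
    exactness modulo [B] yields generation without forming a quotient. *)
Variables (B : {pred M}).
Hypothesis B_closed : zmod_closed B.

(** The path summed over carries [x] rightwards, from [p ++ x :: u ++ v] to [p ++ u ++ x :: v]. *)
Fixpoint move x p u v : M :=
  if u is b :: u' then e p x b (u' ++ v) + move x (rcons p b) u' v else 0.

Lemma move_cat x p u1 u2 v :
  move x p (u1 ++ u2) v = move x p u1 (u2 ++ v) + move x (p ++ u1) u2 v.
Proof.
elim: u1 p => [|b u1 IH] p /=; first by rewrite add0r cats0.
by rewrite IH -catA addrA cat_rcons.
Qed.

(** The strip between the two carrying paths consists of squares, so only its two end edges
    remain. *)
Lemma move_swapr x p u y a b v :
  move x p u (y ++ b :: a :: v) =
  move x p u (y ++ a :: b :: v) + e (p ++ u ++ x :: y) a b v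
  - e (p ++ x :: u ++ y) a b v.
Proof.
elim: u p => [|c u IH] p /=; first by zmod_cancel.
have := e_square_right p x c (u ++ y) a b v; rewrite -!catA => ->.
rewrite IH !cat_rcons; zmod_cancel.
Qed.

Lemma move_swapl x p a b y u v :
  move x (p ++ b :: a :: y) u v =
  move x (p ++ a :: b :: y) u v + e p a b (y ++ u ++ x :: v)
  - e p a b (y ++ x :: u ++ v).
Proof.
elim: u y => [|c u IH] y /=; first by zmod_cancel.
rewrite (e_square_left p a b y x c) !rcons_cat !rcons_cons IH !cat_rcons.
zmod_cancel.
Qed.

(** Here [x] is carried through the swapped pair itself: the strip consists of squares except for
    one hexagon, where [x] meets [a] and [b]. *)
Lemma move_swapm x p u a b v1 v2 :
  move x p (u ++ b :: a :: v1) v2 =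
  move x p (u ++ a :: b :: v1) v2
  + e (p ++ u) a b (v1 ++ x :: v2) - e (p ++ x :: u) a b (v1 ++ v2)
  - hex (p ++ u) x a b (v1 ++ v2).
Proof.
rewrite !move_cat /=.
have -> : rcons (rcons (p ++ u) b) a = (p ++ u) ++ b :: a :: [::].
  by rewrite -!cats1 -!catA.
have -> : rcons (rcons (p ++ u) a) b = (p ++ u) ++ a :: b :: [::].
  by rewrite -!cats1 -!catA.
rewrite move_swapl (move_swapr x p u [::]) /hex /= -!cats1 -!catA /= cats0.
zmod_cancel.
Qed.

(** By [hex_perm] the letters before and after the hexagon can be put in the order of [s]. What
    remains is the order of [b] and [c], which affects only the sign. *)
Lemma hex_critical p x s u b c v : x \notin s -> uniq s ->
    {in critical p (x :: s), forall g, face_hex g \in B} ->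
  perm_eq (u ++ b :: c :: v) s -> hex (p ++ u) x b c v \in B.
Proof.
move=> xs Us crit uvs.
have Uuv : uniq (u ++ b :: c :: v) by rewrite (perm_uniq uvs).
have mems y : y \in s = [|| y \in u, y == b, y == c | y \in v].
  by rewrite -(perm_mem uvs) mem_cat !inE.
move: Uuv; rewrite cat_uniq /= !inE !negb_or.
move=> /and5P[Uu /and3P[bu cu /hasPn uv] /andP[bc bv] cv Uv].
have := faces_filter (mem u) (mem v) s.
set m := [seq y <- s | _ && ~~ _]; set u' := filter _ s; set v' := filter _ s.
have mbc : perm_eq m [:: b; c].
  apply: uniq_perm; rewrite ?filter_uniq //= ?inE ?bc // => y.
  rewrite mem_filter mems !inE /=; case: (y =P b) => [->|_] /=.
    by rewrite bu bv !orbT.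
  case: (y =P c) => [->|_] /=; first by rewrite cu cv !orbT.
  by case: (y \in u) (y \in v) => [] [].
have uu' : perm_eq u' u.
  apply: uniq_perm; rewrite ?filter_uniq // => y.
  by rewrite mem_filter mems /= ; case: (y \in u).
have vv' : perm_eq v' v.
  apply: uniq_perm; rewrite ?filter_uniq // => y.
  rewrite mem_filter mems /=; case yv: (y \in v); last by rewrite andbF.
  by rewrite andbT !orbT andbT; have := uv y yv.
rewrite -size_filter (perm_size mbc) => in_faces.
have /crit : (p ++ u', x :: m, v') \in critical p (x :: s).
  rewrite /= mem_cat; apply/orP; left.
  exact: (map_f (fun f => (p ++ f.1.1, x :: f.1.2, f.2)) in_faces).
have pu : perm_eq (p ++ u') (p ++ u) by rewrite perm_cat2l.
have : m = [:: b; c] \/ m = [:: c; b].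
  move: mbc (perm_size mbc); case: (m) => [|a [|d []]] //= ad _.
  have : a \in [:: b; c] by rewrite -(perm_mem ad) mem_head.
  have perm1 y z : perm_eq [:: y] [:: z] -> y = z.
    by move/perm_mem/(_ y); rewrite !inE eqxx => /esym/eqP.
  rewrite !inE => /orP[] /eqP ea; rewrite {a}ea in ad *.
    by left; move: ad; rewrite perm_cons => /perm1->.
  right; move: ad; rewrite perm_sym (perm_catC [:: b] [:: c]) /= perm_cons.
  by move/perm1->.
move=> mE; rewrite -(hex_perm x b c pu vv').
rewrite /face_hex /=.
by case: mE => -> //= /(GRing.zmod_closedN B_closed); rewrite hex_anti opprK.
Qed.

Definition exact_mod_on (P : seq T -> Prop) p (f : seq T -> M) :=
  forall u a b v, P (u ++ a :: b :: v) ->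
    e (p ++ u) a b v - (f (u ++ b :: a :: v) - f (u ++ a :: b :: v)) \in B.

(* A word [u ++ x :: v] is reached from [x :: u ++ v], whose potential is known
   by induction, by carrying [x] through [u]. *)
Lemma exact_mod p s : uniq s ->
    {in critical p s, forall g, face_hex g \in B} ->
  exists f, exact_mod_on (perm_eq^~ s) p f.
Proof.
have [B0 BB] := B_closed; have BN := GRing.zmod_closedN B_closed.
elim: s p => [|x s IH] p /=.
  by exists (fun=> 0) => u a b v /perm_size; rewrite size_cat addnS.
move=> /andP[xs Us] crit.
have [|f' f'P] := IH (rcons p x) Us.
  by move=> g gs; apply: crit; rewrite mem_cat gs orbT.
pose f z := let i := index x z in
  f' (take i z ++ drop i.+1 z) + move x p (take i z) (drop i.+1 z).
have fE u v : x \notin u -> f (u ++ x :: v) = f' (u ++ v) + move x p u v.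
  move=> xu; rewrite /f index_cat (negbTE xu) /= eqxx addn0 take_size_cat //.
  by rewrite -cat_rcons drop_size_cat ?size_rcons.
exists f => u a b v uvs.
have : uniq (u ++ a :: b :: v) by rewrite (perm_uniq uvs) /= xs.
rewrite cat_uniq /= !inE !negb_or.
move=> /and5P[Uu /and3P[au bu /hasPn uv] /andP[ab av] bv Uv].
have : x \in u ++ a :: b :: v by rewrite (perm_mem uvs) mem_head.
(* Position of [x] relative to the swapped pair. Before it, squares suffice; inside it, the edge is
   one step of a carrying path; after it, a hexagon enters, which lies in [B] by [hex_critical]. *)
rewrite mem_cat !inE => /or4P[xu|/eqP xa|/eqP xb|xv].
- case/splitPr: xu Uu uvs au bu => u1 u2 Uu uvs _ _.
  have xu1 : x \notin u1.
    by move: Uu; rewrite cat_uniq /= => /and3P[_ /norP[]].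
  have uvs' : perm_eq ((u1 ++ u2) ++ a :: b :: v) s.
    by rewrite -(perm_cons x) -(permPr uvs) -!catA /= -cat1s perm_catCA.
  have := f'P _ _ _ _ uvs'; rewrite -!catA !cat_cons !fE // move_swapr cat_rcons.
  by congr (_ \in B); zmod_cancel.
- rewrite -xa in uvs au *; rewrite fE // -cat_rcons fE; last first.
    by rewrite mem_rcons inE negb_or au andbT xa.
  rewrite cat_rcons -cats1 move_cat /=.
  by rewrite (_ : _ - _ = 0) //; zmod_cancel.
- rewrite -xb in uvs bu *; rewrite fE // -(cat_rcons a u (x :: v)) fE; last first.
    by rewrite mem_rcons inE negb_or bu andbT xb eq_sym.
  rewrite cat_rcons -cats1 move_cat /= e_anti.
  by rewrite (_ : _ - _ = 0) //; zmod_cancel.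
- have xu : x \notin u by exact: uv.
  have xa : x != a by apply: contraNneq av => <-.
  have xb : x != b by apply: contraNneq bv => <-.
  case/splitPr: xv Uv uvs {uv av bv} => v1 v2 Uv uvs.
  have xv1 : x \notin v1.
    by move: Uv; rewrite cat_uniq /= => /and3P[_ /norP[]].
  have uvs' : perm_eq (u ++ a :: b :: v1 ++ v2) s.
    rewrite -(perm_cons x) -(permPr uvs).
    have := permEl (perm_catCA [:: x] (u ++ a :: b :: v1) v2).
    by rewrite /= -!catA.
  have uE c d : u ++ c :: d :: v1 ++ x :: v2 = (u ++ c :: d :: v1) ++ x :: v2.
    by rewrite -catA.
  rewrite (uE a b) (uE b a) !fE; first last.
  - by rewrite mem_cat !inE !negb_or xu xa xb.
  - by rewrite mem_cat !inE !negb_or xu xa xb.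
  rewrite (move_swapm x p u a b) -!catA !cat_cons.
  have := f'P _ _ _ _ uvs'; have := hex_critical xs Us crit uvs'.
  move: (hex _ _ _ _ _) => h hB /((GRing.zmod_closedD B_closed).2 _ _ hB).
  by rewrite cat_rcons; congr (_ \in B); zmod_cancel.
Qed.

End Cocycle.

(** The coboundary of [h] telescopes to zero around a closed hexagon. *)
Lemma eq_hex (T : eqType) (M : zmodType) (e e' : seq T -> T -> T -> seq T -> M)
    (h : seq T -> M) :
    (forall u a b v,
       e u a b v = h (u ++ a :: b :: v) + e' u a b v - h (u ++ b :: a :: v)) ->
  forall u x b c v, hex e u x b c v = hex e' u x b c v.
Proof.
move=> ee' u x b c v; rewrite /hex !ee' !cat_rcons.
by zmod_cancel.
Qed.

(** * Signed sweeps of a 2-face *)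

Section Sweep.
Variable T : eqType.
Implicit Types (q u v z : seq T) (b c : T).

(* [z] and [z'] are two maximal chains of the boolean lattice that differ only
   in passing from [q] to [q ++ [:: b; c]] through [b] or through [c]. *)
Definition sweeps q b c z z' :=
  let k := size q in
  [&& perm_eq (take k z) q, z == take k z ++ b :: c :: drop k.+2 z
    & z' == take k z ++ c :: b :: drop k.+2 z].

Definition sweep q b c z z' : int :=
  (sweeps q b c z z')%:Z - (sweeps q b c z' z)%:Z.

Lemma sweepxx q b c z : sweep q b c z z = 0.
Proof. exact: subrr. Qed.

Lemma sweeps_edge q b c u a d v : b != c -> a != d ->
  sweeps q b c (u ++ a :: d :: v) (u ++ d :: a :: v) =
  [&& perm_eq u q, a == b & d == c].
Proof.
move=> bc ad; apply/idP/idP => [|/and3P[uq /eqP-> /eqP->]]; last first.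
  rewrite /sweeps -(perm_size uq) take_size_cat // uq.
  by rewrite -[drop _ _]/(drop (2 + _) _) -drop_drop drop_size_cat //= drop0 !eqxx.
rewrite /sweeps; set t := take _ _; set w := drop _ _ => /and3P[tq /eqP zE /eqP z'E].
(* The two words first differ at position [size u] by one description and at position [size t] by
   the other. *)
have tu : size t = size u.
  apply/eqP; rewrite eqn_leq; apply/andP; split; rewrite leqNgt; apply/negP => tu.
    have := congr1 (fun z => nth a z (size u)) z'E.
    rewrite nth_cat ltnn subnn [RHS]nth_cat tu /= => da.
    have := congr1 (fun z => nth a z (size u)) zE.
    by rewrite nth_cat ltnn subnn [RHS]nth_cat tu /= -da => /eqP; rewrite (negbTE ad).
  have := congr1 (fun z => nth a z (size t)) z'E.
  rewrite [RHS]nth_cat ltnn subnn nth_cat tu /= => ub.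
  have := congr1 (fun z => nth a z (size t)) zE.
  by rewrite [RHS]nth_cat ltnn subnn nth_cat tu /= ub => /eqP; rewrite eq_sym (negbTE bc).
move/eqP: zE; rewrite eqseq_cat ?tu // !eqseq_cons => /and4P[/eqP-> -> -> _].
by rewrite tq.
Qed.

Lemma sweep_edge q b c u a d v : b != c ->
  sweep q b c (u ++ a :: d :: v) (u ++ d :: a :: v) =
  (perm_eq u q)%:Z * (((a == b) && (d == c))%:Z - ((a == c) && (d == b))%:Z).
Proof.
move=> bc; have [<-|ad] := eqVneq a d.
  by rewrite sweepxx [_ && (a == b)]andbC subrr mulr0.
rewrite /sweep !sweeps_edge // 1?eq_sym //.
by case: (perm_eq u q) => /=; rewrite ?mul1r ?mul0r // [(d == b) && _]andbC.
Qed.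

(** Opposite sides of a square have equal sweeps, because [sweep_edge] sees the letters before the
    pair only up to order. *)
Lemma sweep_square q b c u a d x f g v : b != c ->
  let e u a d v := sweep q b c (u ++ a :: d :: v) (u ++ d :: a :: v) in
  e u a d (x ++ f :: g :: v) = e u a d (x ++ g :: f :: v) /\
  e (u ++ d :: a :: x) f g v = e (u ++ a :: d :: x) f g v.
Proof.
move=> bc e; rewrite /e !sweep_edge //; split=> //; congr (_%:Z * _).
rewrite (permPl (_ : perm_eq (u ++ a :: d :: x) (u ++ d :: a :: x))) // perm_cat2l.
by rewrite -[_ :: _]/([:: a] ++ [:: d] ++ x) perm_catCA.
Qed.

Definition face_sweep q b c :=
  face_hex (fun u a d v => sweep q b c (u ++ a :: d :: v) (u ++ d :: a :: v)).

(** As [x] differs from [b] and [c], only the two edges exchanging the last two letters can count.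
    One of them has [x] in front, and [x] is not in [p ++ u]; the other determines the face. *)
Lemma face_sweep_critical p x s u b c v f : uniq s -> x \notin p ++ s ->
    (u, [:: b; c], v) \in faces 2 s -> f \in faces 2 s ->
  face_sweep (p ++ u) b c (p ++ f.1.1, x :: f.1.2, f.2) =
  (f == (u, [:: b; c], v)).
Proof.
move=> Us xps /faces_spec[/= us bcs vs _ uvs].
case: f => [[u' m] v'] /faces_spec[/=].
case: m => [|a [|d []]] //= us' ads vs' _ uvs'.
have bc : b != c by have := subseq_uniq bcs Us; rewrite /= inE andbT.
have [xp xs] : x \notin p /\ x \notin s by apply/norP; rewrite -mem_cat.
have xu : x \notin p ++ u.
  by rewrite mem_cat negb_or xp (contra (@mem_subseq _ _ _ us x)).
have xb : x != b by apply: contraNneq xs => ->; rewrite (mem_subseq bcs) ?mem_head.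
have xc : x != c.
  by apply: contraNneq xs => ->; rewrite (mem_subseq bcs) // !inE eqxx orbT.
rewrite /face_sweep /face_hex /= /hex !sweep_edge //.
rewrite (negbTE xb) (negbTE xc) /= subrr !mulr0 !addr0 !add0r perm_cat2l.
have -> : perm_eq (rcons (p ++ u') x) (p ++ u) = false.
  by apply: contraNF xu => /perm_mem <-; rewrite mem_rcons mem_head.
rewrite mul0r subr0.
have -> : (a == c) && (d == b) = false.
  apply/negP => /andP[/eqP ac /eqP db]; move: ads; rewrite ac db => ads.
  have := subseq_perm_eq Us ads bcs (permEl (perm_catC [:: c] [:: b])).
  by case=> /esym/eqP; rewrite (negbTE bc).
rewrite subr0 -PoszM mulnb; congr (nat_of_bool _)%:Z.
apply/andP/eqP => [[uu' /andP[/eqP ab /eqP dc]]|[-> -> -> _]]; last by rewrite !eqxx.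
rewrite ab dc in uvs' *; have -> := subseq_perm_eq Us us' us uu'.
congr (_, _, _); apply: (subseq_perm_eq Us vs' vs).
rewrite -(perm_cat2l [:: b; c]) -(perm_cat2l u) (permPr uvs).
by rewrite -(permPr uvs') perm_cat2r perm_sym.
Qed.

Lemma face_sweep_notin q b c x g : b != c -> x \notin q -> x \in g.1.1 ->
  face_sweep q b c g = 0.
Proof.
move=> bc xq; case: g => [[u m] v] /= xu; rewrite /face_sweep /face_hex /=.
case: m => [|y [|a [|d [|]]]] //; rewrite /hex !sweep_edge //.
have uq w : x \in w -> perm_eq w q = false.
  by move=> xw; apply: contraNF xq => /perm_mem <-.
by rewrite !uq ?mem_rcons ?inE ?xu ?orbT // !mul0r !addr0.
Qed.

(** Triangular elimination along [s]: testing on [(p ++ u, b, c)] isolates one coefficient with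
    least letter [x], since the later faces have [x] in front and give 0. Those coefficients then
    drop out of the sums. *)
Lemma face_sweep_independent p s (k : seq T * seq T * seq T -> int) :
    uniq (p ++ s) ->
    (forall q b c, b != c ->
       \sum_(g <- critical p s) k g * face_sweep q b c g = 0) ->
  {in critical p s, forall g, k g = 0}.
Proof.
elim: s p => [//|x s IH] p; rewrite -cat_rcons => Ups sum0 /=.
have Us : uniq s by move: Ups; rewrite cat_uniq => /and3P[].
have xps : x \notin p ++ s.
  by move: Ups; rewrite cat_rcons -cat1s uniq_catCA /= => /andP[].
have k0 : {in faces 2 s, forall f, k (p ++ f.1.1, x :: f.1.2, f.2) = 0}.
  move=> [[u m] v] fs; have [/= us ms _ sz_m _] := faces_spec fs.
  case: m sz_m ms fs => [|b [|c []]] //= _ ms fs.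
  have bc : b != c by have := subseq_uniq ms Us; rewrite /= inE andbT.
  have := sum0 (p ++ u) b c bc; rewrite /= big_cat big_map /=.
  rewrite [X in _ + X]big1_seq => [|g /= /critical_prefix/prefixP[w gE]]; last first.
    rewrite (@face_sweep_notin _ _ _ x) ?mulr0 //.
      apply: contra xps; rewrite !mem_cat => /orP[-> //|xu].
      by rewrite (mem_subseq us) ?orbT.
    by rewrite gE mem_cat mem_rcons mem_head.
  rewrite addr0 (bigD1_seq _ fs) ?faces_uniq //= big1_seq => [|f /andP[fne fs']].
    by rewrite (face_sweep_critical Us xps fs fs) eqxx mulr1 addr0.
  by rewrite (face_sweep_critical Us xps fs fs') (negbTE fne) mulr0.
move=> g; rewrite mem_cat => /orP[/mapP[f fs ->]|gs]; first exact: k0.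
apply: (IH (rcons p x)) gs => // q b c bc.
have := sum0 q b c bc; rewrite /= big_cat big_map /=.
by rewrite big1_seq ?add0r // => f /= fs; rewrite k0 // mul0r.
Qed.

End Sweep.

(** * Cocycles on a graph and its discrete fundamental group *)

Section LoopSum.
Local Open Scope quotient_scope.
Variables (G : sgraph) (v0 : G) (M : zmodType) (w : G -> G -> M).

(** Since [adjeq] allows equality, the vertices may coincide: the second condition covers
    backtracking and 3-cycles as well as 4-cycles. *)
Definition graph_cocycle :=
  (forall x, w x x = 0) /\
  (forall x y z t, adjeq G x y -> adjeq G y z -> adjeq G x t -> adjeq G t z ->
     w x y + w y z = w x t + w t z).

Hypothesis w_cocycle : graph_cocycle.
Implicit Types f g : loop v0.

Definition loop_sum f : M := \sum_(0 <= r < loop_len f) w (f r) (f r.+1).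

Lemma loop_len_le f N : loop_bound f N -> (loop_len f <= N)%N.
Proof. by rewrite /loop_len; case: ex_minnP => m _ mP /mP. Qed.

Lemma loop_sumE f N : loop_bound f N ->
  loop_sum f = \sum_(0 <= r < N) w (f r) (f r.+1).
Proof.
move=> fN; rewrite (big_cat_nat (leq0n _) (loop_len_le fN)) //=.
rewrite [X in _ = _ + X]big1_seq ?addr0 // => r.
rewrite mem_index_iota => /and3P[_ fr _]; have fl := loop_lenP f.
by rewrite !(loop_boundE fl) ?w_cocycle.1 // (leq_trans fr).
Qed.

Lemma loop_sum_homo f g : ghsteps f g -> loop_sum f = loop_sum g.
Proof.
elim=> // g1 h _ -> gh {f g}.
have gN := loop_bound_le (loop_lenP g1) (leq_maxl _ (loop_len h)).
have hN := loop_bound_le (loop_lenP h) (leq_maxr (loop_len g1) _).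
rewrite (loop_sumE gN) (loop_sumE hN); apply/eqP; rewrite -subr_eq0 -sumrB.
(* The homotopy step is a ladder between the loops. Each of its squares contributes a difference of
   two rungs, and the rungs telescope. *)
under eq_bigr => r _.
  have -> : w (g1 r) (g1 r.+1) - w (h r) (h r.+1) =
      - (w (g1 r.+1) (h r.+1) - w (g1 r) (h r)).
    have := w_cocycle.2 _ _ _ _ (loopS g1 r) (gh r.+1) (gh r) (loopS h r).
    by move/(canRL (addrK _)) => ->; zmod_cancel.
  over.
rewrite sumrN telescope_sumr // !loop0 w_cocycle.1.
by rewrite (loop_boundE gN) // (loop_boundE hN) // w_cocycle.1 subrr oppr0.
Qed.

Lemma loop_sum_cat f g : loop_sum (loop_cat f g) = loop_sum f + loop_sum g.
Proof.
have fg : loop_bound (loop_cat f g) (loop_len f + loop_len g).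
  apply/asboolP; split; first by rewrite addn_gt0 (loop_bound_gt0 (loop_lenP f)).
  move=> r NMr; rewrite /= /cat_fun; case: leqP => rN.
    by rewrite (loop_boundE (loop_lenP f)) //; lia.
  by rewrite (loop_boundE (loop_lenP g)) //; lia.
rewrite (loop_sumE fg) (big_cat_nat (leq0n _) (leq_addr _ _)) /=; congr (_ + _).
  by apply: eq_big_nat => r /andP[_ rf]; rewrite /cat_fun (ltnW rf) rf.
rewrite -[X in \sum_(X <= _ < _) _](add0n (loop_len f)) big_addn addKn.
apply: eq_big_nat => r _.
have catE k : cat_fun (loop_len f) f g (k + loop_len f) = g k.
  rewrite /cat_fun addnK; case: k => [|k]; last by rewrite ifF //; lia.
  by rewrite leqnn (loop_boundE (loop_lenP f)) ?loop0.
by rewrite /= -addSn (catE r) (catE r.+1).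
Qed.

Definition class_sum (x : A1G v0) : M := loop_sum (repr x).

Lemma class_sumE f : class_sum (\pi_(A1G v0) f) = loop_sum f.
Proof. by apply/loop_sum_homo/A1G_piP; rewrite reprK. Qed.

Lemma class_sumM (x y : A1G v0) : class_sum (x * y)%g = class_sum x + class_sum y.
Proof. by rewrite -loop_sum_cat -class_sumE. Qed.

Definition ab_sum (x : abelianization (A1G v0)) : M := class_sum (repr x).

Lemma ab_sumE (x : A1G v0) : ab_sum (\pi_(abelianization (A1G v0)) x) = class_sum x.
Proof.
have s1 : class_sum 1%g = 0.
  by apply: (addrI (class_sum 1%g)); rewrite -class_sumM mulg1 addr0.
have sV y : class_sum y^-1%g = - class_sum y.
  by apply: (addrI (class_sum y)); rewrite -class_sumM mulgV subrr.
have comm0 y : y \in @commutator_subgroup (A1G v0) -> class_sum y = 0.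
  move/asboolP/(_ [pred y | class_sum y == 0]) => H; apply/eqP; apply: H.
    split=> [|a b]; rewrite !inE ?s1 // => /eqP a0 /eqP b0.
    by rewrite class_sumM sV a0 b0 subrr.
  move=> a b; rewrite inE /commg /conjg !class_sumM !sV; apply/eqP.
  by zmod_cancel.
have /ab_piP : repr (\pi_(abelianization (A1G v0)) x) = x
  %[mod abelianization (A1G v0)] by rewrite reprK.
by rewrite /ab_rel => /comm0; rewrite class_sumM sV addrC => /subr0_eq.
Qed.

Lemma ab_sumD x y : ab_sum (x + y) = ab_sum x + ab_sum y.
Proof. by rewrite -class_sumM -ab_sumE. Qed.

End LoopSum.

(** * Walks and their classes in the abelianized group *)

Section Walk.
Local Open Scope quotient_scope.
Variables (G : sgraph) (v0 : G).
Implicit Types (p q : seq G) (x y z t : G).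
Hint Resolve adjeq_refl : core.

Definition walk x p y := path (adjeq G) x p && (last x p == y).

Lemma walk_cat x p q y : walk x (p ++ q) y = walk x p (last x p) && walk (last x p) q y.
Proof. by rewrite /walk cat_path last_cat eqxx andbT andbA. Qed.

(** Past the end of the list the default [v0] is read, so a closed walk becomes a loop. *)
Definition walk_fun p : ray -> G := nth v0 (v0 :: p).

Lemma walk_is_loop p : walk v0 p v0 -> is_loop v0 (walk_fun p).
Proof.
move=> /andP[/(pathP v0) pP /eqP plast].
have pN r : (size p <= r)%N -> walk_fun p r = v0.
  rewrite /walk_fun leq_eqVlt => /predU1P[<-|pr]; last by rewrite nth_default.
  by rewrite nth_last.
apply: (@mk_is_loop _ _ _ (size p)) => // r.
by case: (ltnP r (size p)) => pr; [exact: pP | rewrite !pN // (leq_trans pr)].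
Qed.

(** Made total by the value 1 on lists that give no loop, so that terms can be rewritten without
    carrying proofs. *)
Definition walk_class p : A1G v0 :=
  if pselect (is_loop v0 (walk_fun p)) is left h then \pi_(A1G v0) (Loop h) else 1%g.

Lemma walk_classE p (h : is_loop v0 (walk_fun p)) :
  walk_class p = \pi_(A1G v0) (Loop h).
Proof.
rewrite /walk_class; case: pselect => // h'.
exact/A1G_piP/eq_ghsteps.
Qed.

Lemma walk_class_step p q : walk v0 p v0 -> walk v0 q v0 ->
  all2 (adjeq G) p q -> walk_class p = walk_class q.
Proof.
move=> wp wq pq.
rewrite (walk_classE (walk_is_loop wp)) (walk_classE (walk_is_loop wq)).
apply/A1G_piP/ghstep1 => -[|r] /=; rewrite /walk_fun //=.
elim: p q r pq {wp wq} => [|x p IH] [|y q] [|r] //=; first by case/andP.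
by move=> /andP[_ /IH].
Qed.

Lemma walk_class_stutter p q : walk v0 (p ++ q) v0 ->
  walk_class (p ++ last v0 p :: q) = walk_class (p ++ q).
Proof.
move=> wpq; have wpq' : walk v0 (p ++ last v0 p :: q) v0.
  by move: wpq; rewrite !walk_cat /walk /= adjeq_refl.
rewrite (walk_classE (walk_is_loop wpq)) (walk_classE (walk_is_loop wpq')).
apply/esym/A1G_piP/(ghsteps_trans (ghsteps_stut (size p) _))/eq_ghsteps => r.
rewrite /= /stut_fun /= /walk_fun -!cat_cons !nth_cat /=.
case: (leqP r (size p)) => [rp|]; first by rewrite ltnS rp.
case: r => // r; rewrite !ltnS subSS leq_eqVlt => /predU1P[<-|pr] /=.
  by rewrite ltnn leqnn subnn nth_last.
by rewrite ltnNge (ltnW pr) leqNgt pr -(subnSK pr).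
Qed.

Lemma walk_class_cat p q : walk v0 p v0 -> walk v0 q v0 ->
  walk_class (p ++ q) = (walk_class p * walk_class q)%g.
Proof.
move=> wp wq; have plast : last v0 p = v0 by case/andP: wp => _ /eqP.
have wpq : walk v0 (p ++ q) v0 by rewrite walk_cat plast wp wq.
rewrite (walk_classE (walk_is_loop wp)) (walk_classE (walk_is_loop wq)).
rewrite (walk_classE (walk_is_loop wpq)) -[RHS]/(A1G_mul _ _) A1G_mulE.
have pN : loop_bound (Loop (walk_is_loop wp)) (size p).+1.
  by apply/asboolP; split=> // r pr; rewrite /= /walk_fun nth_default.
pose st := stut (size p) (Loop (walk_is_loop wpq)).
apply/A1G_piP/(ghsteps_trans _ (catN_indep _ pN _))/(@ghsteps_trans _ _ _ st).
  exact: ghsteps_stut.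
apply: eq_ghsteps => r; rewrite /= /stut_fun /cat_fun /= /walk_fun.
rewrite -!cat_cons !nth_cat /=.
case: (ltngtP r (size p).+1) => [|pr|->].
- by rewrite ltnS => ->.
- rewrite leqNgt ltnW //=; case: r pr => // r; rewrite ltnS => pr /=.
  by rewrite ltnNge pr /= subSS -(subnSK pr).
- by rewrite ltnn /= leqnn [LHS](nth_last v0 (v0 :: p)) /= plast nth_default.
Qed.

Lemma walk_class_nil : walk_class [::] = 1%g.
Proof.
have w0 : walk v0 [::] v0 by rewrite /walk /= eqxx.
by apply: (mulgI (walk_class [::])); rewrite -walk_class_cat // mulg1.
Qed.

(** Stuttering twice at the end of [p] gives a walk of the same length in which [y] is replaced by a
    neighbour: one homotopy step. *)
Lemma walk_class_backtrack p y q :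
    adjeq G (last v0 p) y -> walk v0 (p ++ q) v0 ->
  walk_class (p ++ y :: last v0 p :: q) = walk_class (p ++ q).
Proof.
move=> py wpq; set x := last v0 p in py *.
have wx : walk v0 (p ++ x :: q) v0.
  by move: wpq; rewrite !walk_cat /walk /= adjeq_refl.
rewrite -(walk_class_stutter wpq) -(walk_class_stutter wx) -/x.
apply: walk_class_step.
- by move: wpq; rewrite !walk_cat /walk /= -/x py adjeq_sym py.
- by move: wpq; rewrite !walk_cat /walk /= -/x !adjeq_refl.
- elim: (p) => [|z p' IH] /=; last by rewrite adjeq_refl.
  by rewrite adjeq_sym py adjeq_refl; elim: (q) => //= z q' ->; rewrite adjeq_refl.
Qed.

Definition back x p := rev (belast x p).

Lemma walk_back x p y : walk x p y -> walk y (back x p) x.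
Proof.
rewrite /walk /back => /andP[xp /eqP <-]; rewrite rev_path.
rewrite (@eq_path _ _ (adjeq G)) ?xp => [|z t]; last exact: adjeq_sym.
by case: p {xp} => //= z p; rewrite rev_cons last_rcons eqxx.
Qed.

Lemma walk_class_cancel p q r :
    path (adjeq G) (last v0 p) q -> walk v0 (p ++ r) v0 ->
  walk_class (p ++ q ++ back (last v0 p) q ++ r) = walk_class (p ++ r).
Proof.
elim: q p r => [//|y q IH] p r /= /andP[py yq] wpr.
rewrite /back rev_cons -/(back y q) cat_rcons -[p ++ _ :: _]cat_rcons.
have := IH (rcons p y); rewrite last_rcons => ->//; last first.
  by move: wpr; rewrite -cats1 -catA !walk_cat /walk /= py adjeq_sym py !eqxx.
rewrite cat_rcons; exact: walk_class_backtrack.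
Qed.

Lemma backK x p y : walk x p y -> back y (back x p) = p.
Proof.
case/andP=> _ /eqP <-; rewrite /back.
have := lastI (last x p) (rev (belast x p)).
by rewrite -rev_rcons -lastI rev_cons => /rcons_inj[<- _]; rewrite revK.
Qed.

Section Step.
Variable c : G -> seq G.
Hypothesis cP : forall x, walk v0 (c x) x.
Local Notation Ab := (abelianization (A1G v0)).

Lemma ab_pi1 : \pi_Ab 1%g = 0.
Proof. by []. Qed.

Lemma ab_piM (x y : A1G v0) : \pi_Ab (x * y)%g = \pi_Ab x + \pi_Ab y.
Proof. by rewrite -[RHS]/(ab_add _ _) ab_addE. Qed.

(* The paths [c x] from the base point close up a walk, so that its class
   becomes additive in the walk. *)
Definition walk_ab x p : Ab :=
  \pi_Ab (walk_class (c x ++ p ++ back v0 (c (last x p)))).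

Definition step_ab x y := walk_ab x [:: y].

Lemma walk_based x p : path (adjeq G) x p ->
  walk v0 (c x ++ p ++ back v0 (c (last x p))) v0.
Proof.
move=> xp; rewrite walk_cat; have /andP[_ /eqP cx] := cP x.
rewrite cx cP walk_cat walk_back ?cP // andbT.
by rewrite /walk xp eqxx.
Qed.

Lemma walk_ab_cat x p q : path (adjeq G) x (p ++ q) ->
  walk_ab x (p ++ q) = walk_ab x p + walk_ab (last x p) q.
Proof.
rewrite cat_path => /andP[xp yq]; rewrite /walk_ab -ab_piM -walk_class_cat ?walk_based //.
rewrite last_cat; congr \pi; set y := last x p in yq *; set z := last y q.
have cx : last v0 (c x ++ p) = y by have /andP[_ /eqP cx] := cP x; rewrite last_cat cx.
have wxp : walk v0 (c x ++ p) y.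
  have /andP[cxp /eqP cxl] := cP x.
  by rewrite /walk last_cat cat_path cxp cxl xp /= eqxx.
have wyq : walk y (q ++ back v0 (c z)) v0.
  by rewrite walk_cat walk_back ?cP // andbT /walk yq eqxx.
have := @walk_class_cancel (c x ++ p) (back v0 (c y)) (q ++ back v0 (c z)).
rewrite cx (backK (cP y)) -!catA => -> //; first by have /andP[] := walk_back (cP y).
by rewrite catA walk_cat cx wxp wyq.
Qed.

Lemma walk_ab0 x : walk_ab x [::] = 0.
Proof. by apply: (addrI (walk_ab x [::])); rewrite -walk_ab_cat // addr0. Qed.

Lemma walk_ab_stutter x p q : path (adjeq G) x (p ++ q) ->
  walk_ab x (p ++ last x p :: q) = walk_ab x (p ++ q).
Proof.
move=> xpq; have xpq' : path (adjeq G) x (p ++ last x p :: q).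
  by move: xpq; rewrite !cat_path /= adjeq_refl.
rewrite /walk_ab !last_cat /=; congr \pi; rewrite -!catA /= catA [in RHS]catA.
have := @walk_class_stutter (c x ++ p) (q ++ back v0 (c (last (last x p) q))).
have -> : last v0 (c x ++ p) = last x p.
  by rewrite last_cat; have /andP[_ /eqP->] := cP x.
by apply; have := walk_based xpq; rewrite last_cat -!catA.
Qed.

Lemma step_ab_cocycle : graph_cocycle step_ab.
Proof.
split=> [x|x y z t xy yz xt tz].
  by rewrite /step_ab (@walk_ab_stutter x [::] [::]) // walk_ab0.
have stepE u : adjeq G x u -> adjeq G u z ->
    step_ab x u + step_ab u z = walk_ab x [:: u; z].
  by move=> xu uz; rewrite (@walk_ab_cat x [:: u] [:: z]) //= xu uz.
(* Stuttering at opposite ends gives [x, y, z, z] and [x, x, t, z], which are adjacent or equal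
   place by place. *)
rewrite !stepE // -(@walk_ab_stutter x [:: y; z] [::]) /= ?xy ?yz //.
rewrite -(@walk_ab_stutter x [::] [:: t; z]) /= ?xt ?tz //.
rewrite /walk_ab /=; congr \pi; apply: walk_class_step.
- by apply: (@walk_based x [:: y; z; z]); rewrite /= xy yz adjeq_refl.
- by apply: (@walk_based x [:: x; t; z]); rewrite /= adjeq_refl xt tz.
elim: (c x) => [|u p IH] /=; last by rewrite adjeq_refl; exact: IH.
rewrite adjeq_sym xy adjeq_sym tz adjeq_refl /=.
by elim: (back _ _) => //= u p ->; rewrite adjeq_refl.
Qed.

Lemma walk_ab_sum (f : nat -> G) N : (forall r, adjeq G (f r) (f r.+1)) ->
  walk_ab (f 0%N) [seq f r.+1 | r <- iota 0 N] =
  \sum_(0 <= r < N) step_ab (f r) (f r.+1).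
Proof.
move=> fS; have fP k m : path (adjeq G) (f k) [seq f r.+1 | r <- iota k m].
  by elim: m k => //= m IHm k; rewrite fS IHm.
elim: N => [|N IH]; first by rewrite big_geq // walk_ab0.
have fl : last (f 0%N) [seq f r.+1 | r <- iota 0 N] = f N.
  by case: N {IH} => [|N] //; rewrite -{1}addn1 iotaD map_cat last_cat.
have := fP 0%N (N + 1)%N; rewrite big_nat_recr // -IH -(addn1 N) iotaD map_cat.
by move/walk_ab_cat->; rewrite fl addn1.
Qed.

Lemma walk_ab_closed p : walk v0 p v0 -> walk_ab v0 p = \pi_Ab (walk_class p).
Proof.
move=> wp; have /andP[_ /eqP pl] := wp.
have /walk_back wc := cP v0.
rewrite /walk_ab pl walk_class_cat ?cP //; last by rewrite walk_cat pl wp.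
rewrite walk_class_cat // !ab_piM addrCA -(ab_piM (walk_class (c v0))) -walk_class_cat ?cP //.
have /andP[cp /eqP cl] := cP v0.
have := @walk_class_cancel [::] (c v0) [::] cp; rewrite !cats0 /= => ->.
  by rewrite walk_class_nil ab_pi1 addr0.
by rewrite /walk /= eqxx.
Qed.

Lemma ab_loopE (f : loop v0) :
  \pi_Ab (\pi_(A1G v0) f) =
  \sum_(0 <= r < loop_len f) step_ab (f r) (f r.+1).
Proof.
have fN := loop_lenP f; rewrite -(walk_ab_sum _ (loopS f)) loop0.
set p := map _ _.
have pE r : (r <= loop_len f)%N -> nth v0 (v0 :: p) r = f r.
  case: r => [|r] rf; first by rewrite loop0.
  by rewrite /= (nth_map 0%N) ?size_iota // nth_iota.
have sz_p : size p = loop_len f by rewrite size_map size_iota.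
have wp : walk v0 p v0.
  apply/andP; split; last first.
    by rewrite (last_nth v0) pE ?sz_p // (loop_boundE fN).
  apply/(pathP v0) => r; rewrite sz_p => rf.
  by rewrite pE ?(ltnW rf) // -[nth v0 p r]/(nth v0 (v0 :: p) r.+1) pE // loopS.
rewrite walk_ab_closed // (walk_classE (walk_is_loop wp)); congr \pi.
apply/A1G_piP/eq_ghsteps => r /=; rewrite /walk_fun.
case: (leqP r (loop_len f)) => [/pE //|fr].
by rewrite nth_default /= ?sz_p // (loop_boundE fN) // ltnW.
Qed.

Lemma ab_generated (x : Ab) :
  exists f : loop v0, x = \sum_(0 <= r < loop_len f) step_ab (f r) (f r.+1).
Proof.
elim/quotW: x => x; elim/quotW: x => f; exists f; exact: ab_loopE.
Qed.

(** The loop behind [step_ab x y] also runs along the chosen paths to [x] and [y]; the sums of [w]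
    along these paths make up [h]. *)
Lemma step_ab_dual (M : zmodType) (w : G -> G -> M) : graph_cocycle w ->
  exists (phi : {additive Ab -> M}) (h : G -> M), forall x y, adjeq G x y ->
    phi (step_ab x y) = h x + w x y - h y.
Proof.
move=> wP; pose ws x p := \sum_(i < size p) w (nth v0 (x :: p) i) (nth v0 p i).
have ws_cons x y p : ws x (y :: p) = w x y + ws y p by rewrite /ws big_ord_recl.
have ws_cat x p q : ws x (p ++ q) = ws x p + ws (last x p) q.
  elim: p x => [|y p IH] x; first by rewrite /= {2}/ws big_ord0 add0r.
  by rewrite /= !ws_cons IH addrA.
have classE p : walk v0 p v0 -> ab_sum w (\pi_Ab (walk_class p)) = ws v0 p.
  move=> wp; rewrite ab_sumE // (walk_classE (walk_is_loop wp)) class_sumE //.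
  have pN : loop_bound (Loop (walk_is_loop wp)) (size p).+1.
    by apply/asboolP; split=> // r pr; rewrite /= /walk_fun nth_default.
  rewrite (loop_sumE wP pN) big_nat_recr //= big_mkord [X in _ + X = _](_ : _ = 0).
    by rewrite addr0.
  rewrite {2}/walk_fun nth_default //= /walk_fun (nth_last v0 (v0 :: p)).
  by have /andP[_ /eqP /= ->] := wp; rewrite wP.1.
have ab_sumB : zmod_morphism (ab_sum w : Ab -> M).
  by move=> x y; apply: (canRL (addrK _)); rewrite -ab_sumD // subrK.
pose phi : {additive Ab -> M} :=
  HB.pack (ab_sum w : Ab -> M) (GRing.isZmodMorphism.Build _ _ _ ab_sumB).
pose g x := ws v0 (c x); pose g' x := ws x (back v0 (c x)).
have stepE x y : adjeq G x y -> ab_sum w (step_ab x y) = g x + (w x y + g' y).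
  move=> xy; rewrite /step_ab /walk_ab classE ?walk_based //= ?xy // ws_cat.
  by have /andP[_ /eqP->] := cP x; rewrite ws_cons.
(* The constant step at [y] has class zero, so the sums along the chosen path and along its reverse
   are opposite. *)
have g'E y : g' y = - g y.
  have := stepE y y (adjeq_refl y); rewrite wP.1 add0r (proj1 step_ab_cocycle).
  rewrite -[ab_sum w]/(phi : _ -> _) raddf0.
  by move/esym/eqP; rewrite addrC addr_eq0 => /eqP.
by exists phi, g => x y xy; rewrite -addrA -g'E; exact: stepE.
Qed.

End Step.
End Walk.

(** * The graph of permutations *)

Section Permutahedron.
Local Open Scope group_scope.
Variable n : nat.
Implicit Types (s t : 'S_n) (i j : 'I_n).

Definition perm_word s : seq 'I_n := [seq s i | i <- enum 'I_n].

Lemma perm_word_inj : injective perm_word.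
Proof.
move=> s t st; apply/permP => i.
by move/eq_in_map: st; apply; rewrite mem_enum.
Qed.

Lemma perm_word_perm s : perm_eq (perm_word s) (enum 'I_n).
Proof.
have sI := @perm_inj _ s.
apply: uniq_perm; rewrite ?(map_inj_uniq sI) ?enum_uniq // => i.
by rewrite mem_enum inE -(permKV s i) map_f // mem_enum.
Qed.

Lemma perm_word_surj (z : seq 'I_n) : perm_eq z (enum 'I_n) ->
  exists s, perm_word s = z.
Proof.
move=> zE; have Uz : uniq z by rewrite (perm_uniq zE) enum_uniq.
have sz_z : size z = n by rewrite (perm_size zE) size_enum_ord.
have zinj : injective (fun i => nth i z i).
  move=> i j /eqP; rewrite (set_nth_default i j) ?sz_z //.
  by rewrite nth_uniq ?sz_z // => /eqP/val_inj.
exists (perm zinj); have szw : size (perm_word (perm zinj)) = n.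
  by rewrite size_map size_enum_ord.
have [n0|n_gt0] := posnP n.
  by rewrite (size0nil (etrans szw n0)) (size0nil (etrans sz_z n0)).
pose i0 := Ordinal n_gt0; apply: (@eq_from_nth _ i0) => [|k]; rewrite szw // => kn.
rewrite (nth_map i0) ?size_enum_ord // permE (set_nth_default i0) ?sz_z //.
by rewrite nth_enum_ord.
Qed.

Lemma perm_word_edge i j t : j = i.+1 :> nat ->
  exists u a b v, [/\ size u = i, perm_word t = u ++ a :: b :: v
    & perm_word (tperm i j * t) = u ++ b :: a :: v].
Proof.
move=> ij; set E := enum 'I_n.
have EE : E = take i E ++ i :: j :: drop j.+1 E.
  rewrite -{1}(cat_take_drop i E) (drop_nth i) ?size_enum_ord //; congr (_ ++ _ :: _).
    exact: nth_ord_enum.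
  rewrite -ij (drop_nth i) ?size_enum_ord //; congr (_ :: _).
  exact: nth_ord_enum.
have := enum_uniq 'I_n; rewrite -/E EE cat_uniq /= => /and4P[_ UE iE /andP[jE _]].
have fixE r : {in r, forall k, (k != i) && (k != j)} ->
    [seq (tperm i j * t) k | k <- r] = [seq t k | k <- r].
  move=> rij; apply/eq_in_map => k /rij/andP[ki kj].
  by rewrite permM tpermD // eq_sym.
exists [seq t k | k <- take i E], (t i), (t j), [seq t k | k <- drop j.+1 E].
split; first by rewrite size_map size_takel // size_enum_ord ltnW.
  by rewrite /perm_word -/E {1}EE map_cat.
move: UE iE; rewrite !inE !negb_or => /and3P[iT jT _] /andP[_ iD].
rewrite /perm_word -/E {1}EE map_cat /= !permM tpermL tpermR !fixE // => k kE.
  by apply/andP; split; apply: contraTneq kE => ->.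
by apply/andP; split; apply: contraTneq kE => ->.
Qed.

Lemma GammaB_adjP s t : reflect
  (exists u a b v, perm_word s = u ++ a :: b :: v /\ perm_word t = u ++ b :: a :: v)
  (@adj (GammaB n) s t).
Proof.
apply: (iffP existsP) => [[i /existsP[j /andP[/eqP ji /eqP->]]]|].
  have [u [a [b [v [_ -> ->]]]]] := perm_word_edge t ji.
  by exists u, b, a, v.
move=> [u [a [b [v [su tu]]]]].
have un : ((size u).+1 < n)%N.
  rewrite -[ltnRHS]size_enum_ord -(perm_size (perm_word_perm s)) su.
  by rewrite size_cat /= !addnS ltnS ltnS leq_addr.
pose i := Ordinal (ltnW un); pose j := Ordinal un.
have [u' [a' [b' [v' [u'i tu' su']]]]] := @perm_word_edge i j t erefl.
exists i; apply/existsP; exists j; rewrite eqxx /=; apply/eqP/perm_word_inj.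
rewrite su su'; move/eqP: tu'; rewrite tu eqseq_cat // !eqseq_cons.
by case/and4P => /eqP-> /eqP-> /eqP-> /eqP->.
Qed.

(* The junk value 1 on words that are not arrangements of ['I_n] makes
   [edge_fun_square] below hold for all words. *)
Definition perm_of (z : seq 'I_n) : 'S_n := odflt 1 [pick s | perm_word s == z].

Lemma perm_wordK s : perm_of (perm_word s) = s.
Proof.
rewrite /perm_of; case: pickP => [t /eqP/perm_word_inj //|/(_ s)].
by rewrite eqxx.
Qed.

Lemma perm_ofK z : perm_eq z (enum 'I_n) -> perm_word (perm_of z) = z.
Proof. by move=> /perm_word_surj[s <-]; rewrite perm_wordK. Qed.

Lemma perm_of_default z : ~~ perm_eq z (enum 'I_n) -> perm_of z = 1.
Proof.
move=> zE; rewrite /perm_of; case: pickP => [t /eqP tz|//].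
by rewrite -tz perm_word_perm in zE.
Qed.

Lemma perm_of_edge u a b v :
  adjeq (GammaB n) (perm_of (u ++ a :: b :: v)) (perm_of (u ++ b :: a :: v)).
Proof.
have uv : perm_eq (u ++ a :: b :: v) (u ++ b :: a :: v).
  by rewrite perm_cat2l -[_ :: _]/([:: a] ++ [:: b] ++ v) perm_catCA.
case: (boolP (perm_eq (u ++ a :: b :: v) (enum 'I_n))) => uvE; last first.
  by rewrite !perm_of_default ?adjeq_refl // -(permPl uv).
apply/orP; right; apply/GammaB_adjP; exists u, a, b, v.
by rewrite !perm_ofK // -(permPl uv).
Qed.

Lemma GammaB_connected (s t : GammaB n) : exists p, walk s p t.
Proof.
rewrite -[t]perm_wordK; pose Q z := exists p, walk s p (perm_of z : GammaB n).
apply: (@perm_swap_ind _ Q _ (perm_word s)) => [u a b v [p sp]||].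
- exists (rcons p (perm_of (u ++ b :: a :: v))).
  case/andP: sp => sp /eqP pl.
  by rewrite /walk rcons_path sp pl perm_of_edge last_rcons eqxx.
- by rewrite (permPl (perm_word_perm s)) perm_sym perm_word_perm.
- by exists [::]; rewrite /walk /= perm_wordK.
Qed.

Section EdgeFunction.
Local Open Scope ring_scope.
Variables (M : zmodType) (w : GammaB n -> GammaB n -> M).

Definition edge_fun u a b v : M :=
  w (perm_of (u ++ a :: b :: v)) (perm_of (u ++ b :: a :: v)).

Hypothesis w_cocycle : graph_cocycle w.

Lemma edge_fun_anti u a b v : edge_fun u b a v = - edge_fun u a b v.
Proof.
have uv := perm_of_edge u a b v; have vu := perm_of_edge u b a v.
have := w_cocycle.2 _ _ _ _ uv vu (adjeq_refl _) (adjeq_refl _).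
rewrite !w_cocycle.1 addr0 addrC => /eqP; rewrite addr_eq0.
by move/eqP.
Qed.

Lemma edge_fun_square u a b x c d v :
  edge_fun u a b (x ++ c :: d :: v) + edge_fun (u ++ b :: a :: x) c d v =
  edge_fun (u ++ a :: b :: x) c d v + edge_fun u a b (x ++ d :: c :: v).
Proof.
rewrite /edge_fun -!catA /=; apply: w_cocycle.2; try exact: perm_of_edge.
  by have := perm_of_edge (u ++ b :: a :: x) c d v; rewrite -!catA.
by have := perm_of_edge (u ++ a :: b :: x) c d v; rewrite -!catA.
Qed.

End EdgeFunction.

End Permutahedron.

(** * Products of two simple transpositions *)

Section SwapAt.
Local Open Scope nat_scope.

(** A simple transposition on all natural numbers, so that case analyses on points are left to
    [lia]. *)
Definition swap_at (i m : nat) :=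
  if m == i then i.+1 else if m == i.+1 then i else m.

Ltac swap_at_lia := rewrite /swap_at; repeat case: eqP; lia.

Lemma swap_at_fix i m : (m < i) || (i.+1 < m) -> swap_at i m = m.
Proof. swap_at_lia. Qed.

Lemma swap_at_min i j : i != j -> swap_at i (swap_at j (minn i j)) != minn i j.
Proof.
by move=> ij; rewrite /minn; case: ltnP => ?; swap_at_lia.
Qed.

Lemma swap_at_max i j : i != j ->
  swap_at i (swap_at j (maxn i j).+1) != (maxn i j).+1.
Proof.
by move=> ij; rewrite /maxn; case: ltnP => ?; swap_at_lia.
Qed.

(* The least and the greatest point moved by a product of two distinct simple
   transpositions determine the two factors up to order. *)
Lemma swap_at_inj n i j k l : i < n -> j < n -> k < n -> l < n ->
  (forall m, m <= n -> swap_at i (swap_at j m) = swap_at k (swap_at l m)) ->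
  [\/ i = j /\ k = l, i = k /\ j = l
    | [/\ i = l, j = k & (i.+1 < j) || (j.+1 < i)]].
Proof.
move=> lti ltj ltk ltl.
have [mn1 mn2] : minn i j <= n /\ minn k l <= n by lia.
have [mx1 mx2] : (maxn i j).+1 <= n /\ (maxn k l).+1 <= n by lia.
have sK a m : swap_at a (swap_at a m) = m by swap_at_lia.
have fixl a b m : m < minn a b -> swap_at a (swap_at b m) = m.
  by rewrite ltn_min => /andP[ma mb]; rewrite !swap_at_fix ?ma ?mb.
have fixr a b m : (maxn a b).+1 < m -> swap_at a (swap_at b m) = m.
  by move=> abm; rewrite !swap_at_fix //; lia.
move=> e.
have [ij|ij] := eqVneq i j.
  constructor 1; split=> //; apply/eqP; apply: contraT => /swap_at_min.
  by rewrite -e ?ij ?sK ?eqxx.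
have [kl|kl] := eqVneq k l.
  by have := swap_at_min ij; rewrite e ?kl ?sK ?eqxx.
have lo : minn i j = minn k l.
  case: (ltngtP (minn i j) (minn k l)) => // m.
    by have := swap_at_min ij; rewrite e ?fixl ?eqxx.
  by have := swap_at_min kl; rewrite -e ?fixl ?eqxx.
have hi : maxn i j = maxn k l.
  case: (ltngtP (maxn i j) (maxn k l)) => // m.
    by have := swap_at_max kl; rewrite -e ?fixr ?eqxx.
  by have := swap_at_max ij; rewrite e ?fixr ?eqxx.
(* The factors are now known up to order; for adjacent ones the image of the least moved point
   reveals the order. *)
have {e} : swap_at i (swap_at j (minn i j)) = swap_at k (swap_at l (minn i j)).
  exact: e.
move=> {fixl fixr sK}; have [ik|ik] := eqVneq i k.
  by move=> _; constructor 2; split=> //; lia.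
have [<- <-] : i = l /\ j = k by lia.
move=> e; constructor 3; split=> //; apply: contraT => adj; move: e.
by rewrite /minn; case: ltnP => ?; swap_at_lia.
Qed.

End SwapAt.

(** * Sweeps as cocycles on the graph of permutations *)

Section SweepCocycle.
Variable n : nat.
Implicit Types (s t : 'S_n) (i j : 'I_n).

Lemma sweep_anti (T : eqType) q (b c : T) z z' :
  sweep q b c z' z = - sweep q b c z z'.
Proof. by rewrite /sweep opprB. Qed.

Lemma GammaB_adj_odd s t : @adj (GammaB n) s t -> odd_perm s = ~~ odd_perm t.
Proof.
case/existsP=> i /existsP[j /andP[/eqP ji /eqP->]].
rewrite odd_permM odd_tperm; case: eqP => // ij.
by move: ji; rewrite ij => /n_Sn.
Qed.

Lemma perm_word_far i i' j j' t : i' = i.+1 :> nat -> j' = j.+1 :> nat ->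
    (i.+1 < j)%N ->
  exists u a b x c d v,
    [/\ perm_word t = u ++ a :: b :: x ++ c :: d :: v,
        perm_word (tperm i i' * t)%g = u ++ b :: a :: x ++ c :: d :: v,
        perm_word (tperm j j' * t)%g = u ++ a :: b :: x ++ d :: c :: v
      & perm_word (tperm j j' * (tperm i i' * t))%g =
        u ++ b :: a :: x ++ d :: c :: v].
Proof.
move=> ii' jj' ij.
have [u [a [b [v [ui tE itE]]]]] := perm_word_edge t ii'.
have [y [c [d [v' [yj tE' jtE]]]]] := perm_word_edge t jj'.
have [y' [c' [d' [v'' [yj' itE' jitE]]]]] := perm_word_edge (tperm i i' * t)%g jj'.
have sz_ab e f : (size (u ++ [:: e; f]) <= j)%N by rewrite size_cat ui addn2.
have yE : y = (u ++ [:: a; b]) ++ drop (size (u ++ [:: a; b])) y.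
  rewrite -{1}(cat_take_drop (size (u ++ [:: a; b])) y); congr (_ ++ _).
  rewrite -(@takel_cat _ _ y (c :: d :: v')) ?yj // -tE' tE.
  have -> : u ++ [:: a, b & v] = (u ++ [:: a; b]) ++ v by rewrite -catA.
  by rewrite take_size_cat.
move: yE; set x := drop _ y => yE.
have vE : v = x ++ c :: d :: v'.
  move: tE'; rewrite tE yE -!catA /= => /eqP.
  by rewrite eqseq_cat // !eqseq_cons => /and4P[_ _ _ /eqP].
exists u, a, b, x, c, d, v'; rewrite tE itE jtE jitE vE yE -!catA; split=> //.
move/eqP: itE'; rewrite itE vE.
have -> : u ++ [:: b, a & x ++ [:: c, d & v']] =
    (u ++ [:: b; a] ++ x) ++ [:: c, d & v'] by rewrite -!catA.
rewrite eqseq_cat; last by rewrite yj' -yj yE !size_cat addnA.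
by rewrite !eqseq_cons => /and4P[/eqP<- /eqP<- /eqP<- /eqP<-]; rewrite -!catA.
Qed.

Lemma swap_at_tperm i i' m : i' = i.+1 :> nat ->
  tperm i i' m = swap_at i m :> nat.
Proof.
move=> ii'; rewrite /swap_at -ii' !(inj_eq val_inj); case: tpermP => [->|->|] //.
- by rewrite eqxx.
- by rewrite eqxx; case: eqP => // ->.
by move=> /eqP/negbTE-> /eqP/negbTE->.
Qed.

Lemma sweep_cocycle q (b c : 'I_n) : b != c ->
  graph_cocycle
    (fun s t : GammaB n => sweep q b c (perm_word s) (perm_word t)).
Proof.
move=> bc; pose w (s t : GammaB n) := sweep q b c (perm_word s) (perm_word t).
rewrite -[X in graph_cocycle X]/w; have w0 s : w s s = 0 by exact: sweepxx.
have wV s t : w t s = - w s t by exact: sweep_anti.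
split=> // x y z t xy yz xt tz.
(* Adjacent permutations have opposite parity, so there is no genuine 3-cycle and two of the
   vertices coincide. *)
have triangle x1 x2 x3 : adjeq (GammaB n) x1 x2 -> adjeq (GammaB n) x1 x3 ->
    adjeq (GammaB n) x3 x2 -> w x1 x2 = w x1 x3 + w x3 x2.
  move=> /orP[/eqP<-|/GammaB_adj_odd x12].
    by rewrite w0 [w x3 _]wV subrr.
  move=> /orP[/eqP<-|/GammaB_adj_odd x13]; first by rewrite w0 add0r.
  move=> /orP[/eqP<-|/GammaB_adj_odd x32]; first by rewrite w0 addr0.
  by move: x12; rewrite x13 x32; case: odd_perm.
have [exy|/negbTE xy'] := eqVneq x y.
  by rewrite -exy in yz *; rewrite w0 add0r; apply: triangle.
have [eyz|/negbTE yz'] := eqVneq y z.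
  by rewrite eyz in xy *; rewrite w0 addr0; apply: triangle.
have [ext|/negbTE xt'] := eqVneq x t.
  by rewrite -ext in tz *; rewrite w0 add0r; apply/esym/triangle.
have [etz|/negbTE tz'] := eqVneq t z.
  by rewrite etz in xt *; rewrite w0 addr0; apply/esym/triangle.
have step s1 s2 : adjeq (GammaB n) s1 s2 -> (s1 == s2) = false ->
    exists i i' : 'I_n, i' = i.+1 :> nat /\ s2 = (tperm i i' * s1)%g.
  rewrite adjeq_sym /adjeq eq_sym => /orP[->//|/existsP[i /existsP[j]]].
  by move=> /andP[/eqP ji /eqP->] _; exists i, j.
have [i [i' [ii' yE]]] := step _ _ xy xy'.
have [j [j' [jj' zE]]] := step _ _ yz yz'.
have [k [k' [kk' tE]]] := step _ _ xt xt'.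
have [l [l' [ll' zE']]] := step _ _ tz tz'.
have prodE : (tperm j j' * tperm i i' = tperm l l' * tperm k k')%g.
  by apply: (mulIg x); rewrite -!mulgA -yE -tE -zE.
have swapE m : (m <= n.-1)%N ->
    swap_at i (swap_at j m) = swap_at k (swap_at l m).
  have n0 : (0 < n)%N by case: (i) => a /=; case: (n).
  rewrite -ltnS prednK // => mn; have := congr1 (fun p : 'S_n => p (Ordinal mn)) prodE.
  rewrite !permM => /(congr1 val).
  by rewrite /= !swap_at_tperm.
have lt_pred (a a' : 'I_n) : a' = a.+1 :> nat -> (a < n.-1)%N.
  by move=> aa'; rewrite ltn_predRL -aa'.
have := swap_at_inj (lt_pred _ _ ii') (lt_pred _ _ jj') (lt_pred _ _ kk')
  (lt_pred _ _ ll') swapE.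
have ordE (a a1 c1 c' : 'I_n) : a1 = a.+1 :> nat -> c' = c1.+1 :> nat ->
    a = c1 :> nat -> a = c1 /\ a1 = c'.
  move=> aa cc ac; split; apply: val_inj => //=; by rewrite aa cc ac.
(* Either both paths return to [x], or they coincide, or they are the two sides of a square of
   commuting transpositions. *)
case=> [[ij kl]|[ik jl]|[il jk far]].
- have [ei ei'] := ordE _ _ _ _ ii' jj' ij; have [ek ek'] := ordE _ _ _ _ kk' ll' kl.
  have zx : z = x by rewrite zE yE ei ei' mulgA tperm2 mul1g.
  by rewrite zx [w y x]wV [w t x]wV !subrr.
- have [ei ei'] := ordE _ _ _ _ ii' kk' ik.
  by rewrite (_ : y = t) // yE tE ei ei'.
have [ei ei'] := ordE _ _ _ _ ii' ll' il; have [ej ej'] := ordE _ _ _ _ jj' kk' jk.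
subst l l' k k'; clear il jk prodE swapE step.
wlog ij : i i' j j' y t xy yz xt tz tz' xt' yz' xy' ii' jj' kk' ll' yE zE tE zE'
    far / (i.+1 < j)%N.
  move=> H; case/orP: (far) => ij; first exact: (H i i' j j' y t).
  by apply/esym; apply: (H j j' i i' t y) => //; rewrite ij.
have [u [a [d [x' [f [g [v [xW yW tW zW]]]]]]]] := perm_word_far x ii' jj' ij.
have [sq1 sq2] := sweep_square q u a d x' f g v bc.
rewrite /w zE yE tE xW yW tW zW.
move: sq1 sq2; rewrite -!catA /= => -> ->.
by rewrite addrC.
Qed.

End SweepCocycle.

(** * The rank *)

Section Rank.

Lemma clear_denominators k (v : 'rV[rat]_k) : v != 0 ->
  exists z : 'I_k -> int, (exists i, z i != 0) /\
    exists d : rat, forall i, (z i)%:~R = d * v 0 i.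
Proof.
move=> v0; pose d := \prod_i denq (v 0 i).
have d0 : d != 0 by apply/prodf_neq0 => i _; exact: denq_neq0.
pose z i := numq (v 0 i) * \prod_(j | j != i) denq (v 0 j).
have zE i : (z i)%:~R = d%:~R * v 0 i.
  have -> : d = denq (v 0 i) * \prod_(j | j != i) denq (v 0 j).
    by rewrite /d (bigD1 i).
  by rewrite /z !rmorphM /= numqE mulrAC mulrC mulrA mulrAC.
exists z; split; last by exists d%:~R.
have [i vi] : exists i, v 0 i != 0.
  apply/existsP; apply: contraNT v0; rewrite negb_exists => /forallP v0.
  by apply/eqP/rowP => i; rewrite mxE; apply/eqP; have := v0 i; rewrite negbK.
by exists i; rewrite -(intr_eq0 rat) zE mulf_neq0 ?intr_eq0.
Qed.

(** If [r < k], the coefficient matrix has a non-zero rational vector in its left kernel; cleared of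
    denominators, it is an integer relation among the [y i]. *)
Lemma generated_rank_le (A : zmodType) r k (x : 'I_r -> A) (y : 'I_k -> A) :
    Z_independent y ->
    (forall i, exists c : 'I_r -> int, y i = \sum_j x j *~ c j) ->
  (k <= r)%N.
Proof.
move=> yind /choice[C yE]; rewrite leqNgt; apply/negP => ltrk.
pose m : 'M[rat]_(k, r) := \matrix_(i, j) (C i j)%:~R.
have /rowV0Pn[v /sub_kermxP vm v0] : kermx m != 0.
  rewrite kermx_eq0 -row_leq_rank -ltnNge.
  exact: leq_ltn_trans (rank_leq_col m) ltrk.
have [z [[i zi] [d zE]]] := clear_denominators v0.
case/eqP: zi; apply: yind => {i}.
under eq_bigr => i _ do rewrite yE mulrz_suml.
rewrite exchange_big /= big1 // => j _.
under eq_bigr => i _ do rewrite -mulrzA.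
rewrite -mulrz_sumr (_ : \sum_i _ = 0) ?mulr0z //.
apply/eqP; rewrite -(intr_eq0 rat) rmorph_sum /=.
under eq_bigr => i _ do rewrite rmorphM /= zE mulrC -mulrA.
rewrite -mulr_sumr; have /rowP/(_ j) := vm; rewrite !mxE => vmj.
rewrite (_ : \sum_i _ = 0) ?mulr0 //.
by rewrite -[RHS]vmj; apply: eq_bigr => i _; rewrite mxE.
Qed.

Lemma rank_formula n :
  ((\sum_(k < n) 'C(k, 2) * 2 ^ (k - 2))%N%:R : rat) =
  2%:R ^ (n%:Z - 3%:Z) * (n%:R ^+ 2 - 5%:R * n%:R + 8%:R) - 1.
Proof.
rewrite expfzDr // -exprnP.
rewrite (_ : (2%:R : rat) ^ (- 3%:Z) = 8%:R^-1) //.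
elim: n => [|n IH]; first by rewrite big_ord0.
rewrite big_ord_recr /= natrD IH.
(* Eight times the new summand is [(n * n - n) * 2 ^ n], stated additively. The truncation in
   [n - 2] is harmless, as the binomial vanishes for [n < 2]. *)
have binE : (8 * ('C(n, 2) * 2 ^ (n - 2)) + n * 2 ^ n = n * n * 2 ^ n)%N.
  case: n {IH} => [|[|n]] //; rewrite subn2 /= !expnS.
  have := mul_bin_diag n.+2 1; rewrite bin1 /=.
  move: (2 ^ n)%N ('C(n.+2, 2)) => a b; nia.
have {binE} := congr1 (fun m => m%:R : rat) binE.
rewrite !(natrD, natrM, natrX) (exprS _ n) -(natr1 n) => binE.
have -> : 'C(n, 2)%:R * 2%:R ^+ (n - 2) =
    (n%:R * n%:R - n%:R) * 2%:R ^+ n / 8%:R :> rat by lra.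
by field.
Qed.
End Rank.

Lemma raddf_hex (T : eqType) (M N : zmodType) (phi : {additive M -> N})
    (e : seq T -> T -> T -> seq T -> M) u x b c v :
  phi (hex e u x b c v) = hex (fun u a d v => phi (e u a d v)) u x b c v.
Proof. by rewrite /hex raddfB !raddfD. Qed.

(** * The critical hexagons form a basis *)

Section GammaBRank.
Variables (n : nat) (v0 : GammaB n).
Local Notation Ab := (abelianization (A1G v0)).
Local Notation chambers := (critical [::] (enum 'I_n)).

Variable c : GammaB n -> seq (GammaB n).
Hypothesis cP : forall s, walk v0 (c s) s.

Let e := edge_fun (step_ab v0 c).

Let step_cocycle : graph_cocycle (step_ab v0 c) := step_ab_cocycle cP.

(** [step_ab_dual] realizes the sweep cocycle up to a coboundary, which hexagons do not see by
    [eq_hex]. *)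
Lemma sweep_functional q b d : b != d ->
  exists phi : {additive Ab -> int},
    {in chambers, forall g, phi (face_hex e g) = face_sweep q b d g}.
Proof.
move=> bd; have [phi [h phiE]] := step_ab_dual cP (sweep_cocycle q bd).
exists phi => g /critical_spec[x [a [f [gm gE]]]].
rewrite /face_sweep /face_hex gm raddf_hex.
pose w (s t : GammaB n) := sweep q b d (perm_word s) (perm_word t).
rewrite (@eq_hex _ _ _ (edge_fun w) (fun z => h (perm_of z))) => [|u y z v]; last first.
  exact/phiE/perm_of_edge.
move: gE; move: g.1.1 g.2 {gm} => u v uvE.
have wE r y z s : perm_eq (r ++ y :: z :: s) (u ++ x :: a :: f :: v) ->
    edge_fun w r y z s = sweep q b d (r ++ y :: z :: s) (r ++ z :: y :: s).
  rewrite (permPr uvE) => rE; rewrite /edge_fun /w !perm_ofK //.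
  by rewrite -(permPr rE) perm_cat2l -[_ :: _]/([:: z] ++ [:: y] ++ s) perm_catCA.
rewrite /hex !wE //; rewrite ?cat_rcons perm_cat2l; apply/seq.permP => p /=; lia.
Qed.

Lemma chambers_independent :
  Z_independent (fun i : 'I_(size chambers) =>
    face_hex e (nth ([::], [::], [::]) chambers i)).
Proof.
move=> k sum0; set g0 := ([::], [::], [::]) in sum0.
have U : uniq chambers by apply: critical_uniq; exact: enum_uniq.
pose K g := if insub (index g chambers) is Some i then k i else 0.
have KE (i : 'I_(size chambers)) : K (nth g0 chambers i) = k i.
  by rewrite /K index_uniq // valK.
move=> i; rewrite -KE; apply: (@face_sweep_independent _ [::] (enum 'I_n) K).
- exact: enum_uniq.
- move=> q b d bd; have [phi phiE] := sweep_functional q bd.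
  rewrite (big_nth g0) big_mkord -[RHS](raddf0 phi) -sum0 raddf_sum /=.
  by apply: eq_bigr => j _; rewrite KE raddfMz phiE ?mem_nth // mulrC mulrzz.
- exact: mem_nth.
Qed.

Lemma chambers_generate (a : Ab) : exists k : 'I_(size chambers) -> int,
  a = \sum_(i < size chambers)
        face_hex e (nth ([::], [::], [::]) chambers i) *~ k i.
Proof.
set g0 := ([::], [::], [::]).
(* The span of the critical hexagons, modulo which [exact_mod] provides a potential. *)
pose B : {pred Ab} := fun y => `[< exists k : 'I_(size chambers) -> int,
  y = \sum_(i < size chambers) face_hex e (nth g0 chambers i) *~ k i >].
apply/asboolP; rewrite -[asbool _]/(a \in B).
have B_closed : zmod_closed B.
  split=> [|y z /asboolP[k ->] /asboolP[l ->]]; apply/asboolP.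
    by exists (fun=> 0); rewrite big1.
  exists (fun i => k i - l i); rewrite -sumrB.
  by apply: eq_bigr => i _; rewrite mulrzBr.
have U : uniq chambers by apply: critical_uniq; exact: enum_uniq.
have [g gL|f fP] := exact_mod (edge_fun_anti step_cocycle)
    (edge_fun_square step_cocycle) B_closed (p := [::]) (enum_uniq 'I_n).
  have lt_g : (index g chambers < size chambers)%N by rewrite index_mem.
  apply/asboolP; exists (fun i => (i == Ordinal lt_g)%:Z).
  rewrite (bigD1 (Ordinal lt_g)) //= eqxx nth_index // big1 ?addr0 // => i.
  by move/negbTE->.
have [h ->] := ab_generated cP a.
pose F r := f (perm_word (h r)).
(* The increments of the potential sum to zero along a loop; once they are subtracted, each summand
   lies in [B]. *)
have -> : \sum_(0 <= r < loop_len h) step_ab v0 c (h r) (h r.+1) =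
    \sum_(0 <= r < loop_len h)
      (step_ab v0 c (h r) (h r.+1) - (F r.+1 - F r)).
  rewrite sumrB telescope_sumr // /F loop0 (loop_boundE (loop_lenP h)) //.
  by rewrite subrr subr0.
apply: (big_ind (fun y => y \in B)) => [|y z|r _].
- exact: B_closed.1.
- exact: (GRing.zmod_closedD B_closed).2.
rewrite /F; case/orP: (loopS h r) => [/eqP<-|].
  by rewrite step_cocycle.1 !subrr; exact: B_closed.1.
case/GammaB_adjP=> [u [x [y [v [hr hr1]]]]].
have := fP u x y v; rewrite -hr -hr1 /edge_fun => /(_ (perm_word_perm _)).
by rewrite /e /edge_fun /= -hr -hr1 !perm_wordK.
Qed.

Lemma rank_A1G_GammaB : has_rank Ab (size chambers).
Proof.
split; first by eexists; exact: chambers_independent.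
move=> k y /generated_rank_le; apply => i; exact: chambers_generate.
Qed.

End GammaBRank.

Theorem theorem5p7 (n : nat) (hn : (1 <= n)%N) (v0 : GammaB n) :
  exists r : nat,
    has_rank (abelianization (A1G v0)) r /\
    ((r%:R : rat) =
       2%:R ^ (n%:Z - 3%:Z) * (n%:R ^+ 2 - 5%:R * n%:R + 8%:R) - 1)%R.
Proof.
have [c cP] := choice (GammaB_connected v0).
exists (size (critical [::] (enum 'I_n))); split; first exact: rank_A1G_GammaB cP.
by rewrite size_critical size_enum_ord rank_formula.
Qed.
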